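(* Let $k$ be a field, let $(\mathcal{H}_1,\mu_1,\eta_1,\Delta_1,\varepsilon_1,S_1)$ be an $m_1$-inverse property Hopf quasigroup over $k$ such that $S_1(\delta_1)=\delta_1$ and $S_1^{h_1}\in\mathrm{Aut}(\mathcal{H}_1)$, and let $(\mathcal{H}_2,\mu_2,\eta_2,\Delta_2,\varepsilon_2,S_2)$ be an $m_2$-inverse property Hopf quasigroup such that $S_2(\delta_2)=\delta_2$ and $S_2^{h_2}\in\mathrm{Aut}(\mathcal{H}_2)$, where $\delta_i=\eta_i(1)$ and $m_i,h_i\in\mathbb{Z}$. Let $m\in\mathbb{Z}$ satisfy $m\equiv m_1\ (\mathrm{mod}\ h_1)$ and $m\equiv m_2\ (\mathrm{mod}\ h_2)$, and let $\mathcal{G}$ be an $m$-inverse property Hopf quasigroup with antipode $S$ such that $\mathcal{H}_1$ and $\mathcal{H}_2$ are $m$-inverse Hopf quasi-subgroups of $\mathcal{G}$. Suppose that the multiplication of $\mathcal{G}$ yields an isomorphism of vector spaces $$\Theta:\mathcal{H}_1\otimes\mathcal{H}_2\to\mathcal{G},\qquad h\otimes h'\mapsto hh',$$ that $$(hh')g=h(h'g),\qquad g(hh')=(gh)h',$$ and that $$S(hh')=S_2(h')S_1(h),\qquad S(h'h)=S_1(h)S_2(h')$$ for all $h\in\mathcal{H}_1$, $h'\in\mathcal{H}_2$, $g\in\mathcal{G}$. Then $(\mathcal{H}_1,\mathcal{H}_2)$ is a matched pair of $m$-inverse property Hopf quasigroups, and $\mathcal{G}\cong\mathcal{H}_1\bowtie\mathcal{H}_2$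 as Hopf quasigroups.
   Context: Sweedler notation $\Delta(h)=h_{(1)}\otimes h_{(2)}$ (summation suppressed) is used; $\phi(h',h)$ means $\phi(h'\otimes h)$, similarly for $\psi$. For $m\in\mathbb{Z}$, an $m$-inverse property Hopf quasigroup over $k$ is a $k$-linear space $\mathcal{H}$ with linear maps $\mu:\mathcal{H}\otimes\mathcal{H}\to\mathcal{H}$, $\eta:k\to\mathcal{H}$, $\Delta:\mathcal{H}\to\mathcal{H}\otimes\mathcal{H}$, $\varepsilon:\mathcal{H}\to k$, $S:\mathcal{H}\to\mathcal{H}$ such that, with $\delta:=\eta(1)$: (i) $(\mathcal{H},\mu,\eta)$ is a unital, not necessarily associative algebra; (ii) $(\mathcal{H},\Delta,\varepsilon)$ is a coassociative counital coalgebra; (iii) $\Delta$ and $\varepsilon$ are multiplicative; (iv) $S$ is the unique coalgebra anti-automorphism (bijective, $\Delta(S(h))=S(h_{(2)})\otimes S(h_{(1)})$, $\varepsilon\circ S=\varepsilon$) satisfying $h_{(1)}S(h_{(2)})=\varepsilon(h)\delta=S(h_{(1)})h_{(2)}$ for all $h$, and moreover $S^m(h_{(2)}g)\,S^{m+1}(h_{(1)})=\varepsilon(h)S^m(g)$ for all $h,g\in\mathcal{H}$. A Hopf quasi-subgroup is a linear subspace which is a Hopf quasigroup of this type with the restricted structure maps. Isomorphism of Hopf quasigroups means a linear isomorphism compatible with all structure maps. $S^r\in\mathrm{Aut}(\mathcal{H})$ means $S^r(hg)=S^r(h)S^r(g)$ and $\Delta(S^r(h))=S^r(h_{(1)})\otimes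 S^r(h_{(2)})$ for all $h,g\in\mathcal{H}$. With $\mathcal{H}_1,\mathcal{H}_2,m$ as in the statement, $(\mathcal{H}_1,\mathcal{H}_2)$ is a matched pair of $m$-inverse property Hopf quasigroups if there are linear maps $\phi:\mathcal{H}_2\otimes\mathcal{H}_1\to\mathcal{H}_1$ and $\psi:\mathcal{H}_2\otimes\mathcal{H}_1\to\mathcal{H}_2$ such that for all $h,g\in\mathcal{H}_1$, $h'\in\mathcal{H}_2$: (1) $\phi(\delta_2,h)=h$, $\phi(h',\delta_1)=\varepsilon_2(h')\delta_1$, $\psi(\delta_2,h)=\varepsilon_1(h)\delta_2$, $\psi(h',\delta_1)=h'$; (2) $\phi(S_2(h'_{(1)}),\phi(h'_{(2)},h))=\varepsilon_2(h')h=\phi(h'_{(1)},\phi(S_2(h'_{(2)}),h))$; (3) $\psi\big(\psi(h',S_1^m(h_{(2)}g)),S_1^{m+1}(h_{(1)})\big)=\varepsilon_1(h)\psi(h',S_1^m(g))$; (4) $\psi(\psi(h',S_1(h_{(1)})),h_{(2)})=\varepsilon_1(h)h'=\psi(\psi(h',h_{(1)}),S_1(h_{(2)}))$; (5) $\Delta_1(\phi(h',h))=\phi(h'_{(1)},h_{(1)})\otimes\phi(h'_{(2)},h_{(2)})$ and $\varepsilon_1(\phi(h',h))=\varepsilon_1(h)\varepsilon_2(h')$; (6) $\Delta_2(\psi(h',h))=\psi(h'_{(1)},h_{(1)})\otimes\psi(h'_{(2)},h_{(2)})$ and $\varepsilon_2(\psi(h',h))=\varepsilon_1(h)\varepsilon_2(h')$;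 (7) $\varepsilon_1(h)\phi(h',S_1^m(g))$ equals $\phi(h'_{(1)},S_1^m(h_{(3)}g_{(2)}))\,\phi\big(\psi(h'_{(2)},S_1^m(h_{(2)}g_{(1)})),S_1^{m+1}(h_{(1)})\big)$ if $m$ is odd, and equals $\phi(h'_{(1)},S_1^m(h_{(2)}g_{(1)}))\,\phi\big(\psi(h'_{(2)},S_1^m(h_{(3)}g_{(2)})),S_1^{m+1}(h_{(1)})\big)$ if $m$ is even; (8) $\phi(h'_{(1)},S_1(h_{(2)}))\,\phi(\psi(h'_{(2)},S_1(h_{(1)})),h_{(3)})=\varepsilon_1(h)\varepsilon_2(h')\delta_1=\phi(h'_{(1)},h_{(1)})\,\phi(\psi(h'_{(2)},h_{(2)}),S_1(h_{(3)}))$; (9) $\psi(S_2(h'_{(1)}),\phi(h'_{(2)},h_{(1)}))\,\psi(h'_{(3)},h_{(2)})=\varepsilon_1(h)\varepsilon_2(h')\delta_2=\psi(h'_{(1)},\phi(S_2(h'_{(3)}),h_{(1)}))\,\psi(S_2(h'_{(2)}),h_{(2)})$; (10) $\psi(h'_{(1)},h_{(1)})\otimes\phi(h'_{(2)},h_{(2)})=\psi(h'_{(2)},h_{(2)})\otimes\phi(h'_{(1)},h_{(1)})$. Then $\mathcal{H}_1\bowtie\mathcal{H}_2$ denotes $\mathcal{H}_1\otimes\mathcal{H}_2$ with unit $\delta_1\otimes\delta_2$, comultiplication $h\otimes h'\mapsto(h_{(1)}\otimes h'_{(1)})\otimes(h_{(2)}\otimes h'_{(2)})$, counit $\varepsilon_1\otimes\varepsilon_2$,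 multiplication $(h\otimes h')(g\otimes g'):=h\,\phi(h'_{(1)},g_{(1)})\otimes\psi(h'_{(2)},g_{(2)})\,g'$, and antipode $S_{\bowtie}(h\otimes h'):=\phi(S_2(h'_{(2)}),S_1(h_{(2)}))\otimes\psi(S_2(h'_{(1)}),S_1(h_{(1)}))$. The claim is that such $\phi,\psi$ exist for which $\mathcal{G}\cong\mathcal{H}_1\bowtie\mathcal{H}_2$. *)

(* Defs.v *)
From HB Require Import structures.
From mathcomp Require Import all_boot all_order all_algebra.
From mathcomp Require Import boolp classical_sets functions.

Set Implicit Arguments.
Unset Strict Implicit.
Unset Printing Implicit Defensive.

Import GRing.Theory.
Local Open Scope ring_scope.
Local Open Scope quotient_scope.

Definition bilin (R : nzRingType) (U V W : lmodType R) (F : U -> V -> W) : Prop :=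
  (forall v, linear (F^~ v)) /\ (forall u, linear (F u)).

(* Tensor product of two (possibly infinite-dimensional) k-spaces: finite     *)
(* formal sums of pairs, modulo the congruence generated by commutativity and *)
(* bilinearity. Scalars need not be carried by the formal sums, since         *)
(* c (u (x) v) = (c u) (x) v.                                                 *)
Section Tensor.
Context (k : fieldType) (U V : lmodType k).

Inductive tens_rel : seq (U * V) -> seq (U * V) -> Prop :=
| TensRefl s : tens_rel s s
| TensSym s t : tens_rel s t -> tens_rel t s
| TensTrans s t r : tens_rel s t -> tens_rel t r -> tens_rel s r
| TensCat s s' t t' :
    tens_rel s s' -> tens_rel t t' -> tens_rel (s ++ t) (s' ++ t')
| TensComm s t : tens_rel (s ++ t) (t ++ s)
| TensAddl u u' v : tens_rel [:: (u + u', v)] [:: (u, v); (u', v)]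
| TensAddr u v v' : tens_rel [:: (u, v + v')] [:: (u, v); (u, v')]
| TensScale (a : k) u v : tens_rel [:: (a *: u, v)] [:: (u, a *: v)]
| TensZero v : tens_rel [:: (0, v)] [::].

Definition tens_eqb : rel (seq (U * V)) := fun s t => `[< tens_rel s t >].

Lemma tens_eqb_refl : reflexive tens_eqb.
Proof. by move=> s; apply/asboolP/TensRefl. Qed.

Lemma tens_eqb_sym : symmetric tens_eqb.
Proof. by move=> s t; apply/asboolP/asboolP => /TensSym. Qed.

Lemma tens_eqb_trans : transitive tens_eqb.
Proof.
move=> t s r /asboolP st /asboolP tr; apply/asboolP; exact: TensTrans st tr.
Qed.

Canonical tens_equiv := EquivRel tens_eqb tens_eqb_refl tens_eqb_sym tens_eqb_trans.
Canonical tens_equiv_direct := defaultEncModRel tens_eqb.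

Definition tens := {eq_quot tens_eqb}.
HB.instance Definition _ := Choice.on tens.
HB.instance Definition _ := Quotient.on tens.
HB.instance Definition _ : EqQuotient _ tens_eqb tens := EqQuotient.on tens.

Definition tclass (s : seq (U * V)) : tens := \pi_tens s.
Definition trep (t : tens) : seq (U * V) := repr t.

Lemma tclassP s t : reflect (tclass s = tclass t) `[< tens_rel s t >].
Proof. exact: eqquotP. Qed.

Lemma tclass_eq s t : tens_rel s t -> tclass s = tclass t.
Proof. by move=> st; apply/tclassP/asboolP. Qed.

Lemma trepK t : tclass (trep t) = t.
Proof. exact: reprK. Qed.

Lemma trep_rel s : tens_rel (trep (tclass s)) s.
Proof. by apply/asboolP/tclassP; rewrite trepK. Qed.

Definition fscale (a : k) (s : seq (U * V)) := [seq (a *: p.1, p.2) | p <- s].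

Lemma tens_rel_scale a s t : tens_rel s t -> tens_rel (fscale a s) (fscale a t).
Proof.
elim=> {s t} /=.
- by move=> s; exact: TensRefl.
- by move=> s t _; exact: TensSym.
- by move=> s t r _ st _ tr; exact: TensTrans st tr.
- by move=> s s' t t' _ ss' _ tt'; rewrite /fscale !map_cat; exact: TensCat.
- by move=> s t; rewrite /fscale !map_cat; exact: TensComm.
- by move=> u u' v; rewrite scalerDr; exact: TensAddl.
- by move=> u v v'; exact: TensAddr.
- move=> b u v; rewrite scalerA mulrC -scalerA; exact: TensScale.
- by move=> v; rewrite scaler0; exact: TensZero.
Qed.

Definition tadd (x y : tens) : tens := tclass (trep x ++ trep y).
Definition tscale (a : k) (x : tens) : tens := tclass (fscale a (trep x)).

Lemma tadd_class s t : tadd (tclass s) (tclass t) = tclass (s ++ t).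
Proof. by apply: tclass_eq; apply: TensCat; exact: trep_rel. Qed.

Lemma tscale_class a s : tscale a (tclass s) = tclass (fscale a s).
Proof. by apply: tclass_eq; apply: tens_rel_scale; exact: trep_rel. Qed.

Lemma taddA : associative tadd.
Proof.
by move=> x y z; rewrite -[x]trepK -[y]trepK -[z]trepK !tadd_class catA.
Qed.

Lemma taddC : commutative tadd.
Proof. by move=> x y; apply: tclass_eq; exact: TensComm. Qed.

Lemma tadd0 : left_id (tclass [::]) tadd.
Proof. by move=> x; rewrite -[x]trepK tadd_class. Qed.

Lemma tscaleDl x : {morph tscale^~ x : a b / a + b >-> tadd a b}.
Proof.
move=> a b; rewrite -[x]trepK !tscale_class tadd_class; apply: tclass_eq.
elim: (trep x) => [|[u v] s IH] /=; first exact: TensRefl.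
rewrite scalerDl; apply: TensTrans.
  by apply: (TensCat (TensAddl (a *: u) (b *: u) v) IH).
rewrite /=; apply: (@TensCat [:: (a *: u, v)] [:: (a *: u, v)]); first exact: TensRefl.
rewrite -/(fscale a s) -/(fscale b s) -cat1s catA.
rewrite -[fscale a s ++ (b *: u, v) :: _]/(fscale a s ++ ([:: (b *: u, v)] ++ fscale b s)).
rewrite [in X in tens_rel _ X]catA.
by apply: TensCat; [exact: TensComm | exact: TensRefl].
Qed.

Lemma tscale0 x : tscale 0 x = tclass [::].
Proof.
rewrite -[x]trepK tscale_class; apply: tclass_eq.
elim: (trep x) => [|[u v] s IH] /=; first exact: TensRefl.
by rewrite scale0r; apply: (TensCat (TensZero v) IH).
Qed.

Lemma tscale1 : left_id 1 tscale.
Proof.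
move=> x; rewrite -[RHS]trepK; congr tclass.
by rewrite /fscale -[RHS]map_id; apply: eq_map => -[u v] /=; rewrite scale1r.
Qed.

Lemma tscaleA a b x : tscale a (tscale b x) = tscale (a * b) x.
Proof.
rewrite -[x]trepK !tscale_class; congr tclass; rewrite /fscale -map_comp.
by apply: eq_map => -[u v] /=; rewrite scalerA.
Qed.

Lemma taddN : left_inverse (tclass [::]) (tscale (-1)) tadd.
Proof.
by move=> x; rewrite -{2}[x]tscale1 -tscaleDl addNr tscale0.
Qed.

HB.instance Definition _ := GRing.isZmodule.Build tens taddA taddC tadd0 taddN.

Lemma tscaleDr : right_distributive tscale +%R.
Proof.
move=> a x y; rewrite -[x]trepK -[y]trepK.
rewrite -![_ + _]/(tadd _ _) tadd_class !tscale_class tadd_class.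
by rewrite /fscale map_cat.
Qed.

HB.instance Definition _ :=
  GRing.Zmodule_isLmodule.Build k tens tscaleA tscale1 tscaleDr tscaleDl.

Definition tpure (u : U) (v : V) : tens := tclass [:: (u, v)].

Lemma tpure_bilin : bilin tpure.
Proof.
split=> [v a u u'|u a v v'].
- rewrite [a *: tpure u v]tscale_class /= [_ + _ in RHS]tadd_class.
  by apply: tclass_eq; exact: TensAddl.
- rewrite [a *: tpure u v]tscale_class /= [_ + _ in RHS]tadd_class.
  apply: tclass_eq; apply: TensTrans (TensAddr _ _ _) _.
  apply: (@TensCat [:: _] [:: _] [:: _] [:: _]); last exact: TensRefl.
  exact/TensSym/TensScale.
Qed.

Lemma tpure_sum t : t = \sum_(p <- trep t) tpure p.1 p.2.
Proof.
rewrite -{1}[t]trepK; elim: (trep t) => [|[u v] s IH]; first by rewrite big_nil.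
by rewrite big_cons /= -IH -[_ + _]/(tadd _ _) tadd_class.
Qed.

(* [tlift F t] is \sum_i F u_i v_i for a chosen expression                    *)
(* t = \sum_i u_i (x) v_i. It is only meaningful for bilinear F, for which it *)
(* does not depend on the choice and is the linear map induced by F.          *)
Definition tlift (W : lmodType k) (F : U -> V -> W) (t : tens) : W :=
  \sum_(p <- trep t) F p.1 p.2.

Section Lift.
Context (W : lmodType k) (F : U -> V -> W).
Hypothesis bF : bilin F.

Let Fl0 v : F 0 v = 0.
Proof.
by have := bF.1 v (-1) 0 0; rewrite scaler0 addr0 scaleN1r addNr.
Qed.

Lemma tlift_rel s t : tens_rel s t ->
  \sum_(p <- s) F p.1 p.2 = \sum_(p <- t) F p.1 p.2.
Proof.
elim=> {s t} /=.
- by [].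
- by [].
- by move=> s t r _ -> _ ->.
- by move=> s s' t t' _ e _ e'; rewrite !big_cat /= e e'.
- by move=> s t; rewrite !big_cat /= addrC.
- move=> u u' v; rewrite !big_cons !big_nil /= !addr0.
  by have := bF.1 v 1 u u'; rewrite !scale1r.
- move=> u v v'; rewrite !big_cons !big_nil /= !addr0.
  by have := bF.2 u 1 v v'; rewrite !scale1r.
- move=> a u v; rewrite !big_cons !big_nil /= !addr0.
  have := bF.1 v a u 0; rewrite !addr0 Fl0 addr0 => ->.
  have := bF.2 u a v 0; rewrite addr0 => ->.
  suff -> : F u 0 = 0 by rewrite addr0.
  by have := bF.2 u (-1) 0 0; rewrite scaler0 addr0 scaleN1r addNr.
- by move=> v; rewrite big_seq1 big_nil.
Qed.

Lemma tlift_pure u v : tlift F (tpure u v) = F u v.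
Proof. by rewrite /tlift (tlift_rel (trep_rel _)) big_seq1. Qed.

Lemma tlift_linear : linear (tlift F).
Proof.
move=> a x y; rewrite -[x]trepK -[y]trepK.
rewrite [a *: _]tscale_class [tclass _ + _]tadd_class /tlift.
rewrite !(tlift_rel (trep_rel _)) big_cat /= big_map /=; congr (_ + _).
rewrite scaler_sumr; apply: eq_bigr => p _.
by have := bF.1 p.2 a p.1 0; rewrite !addr0 Fl0 addr0.
Qed.

End Lift.

Lemma tlift_linear_fun (Z W : lmodType k) (F : Z -> U -> V -> W) t :
  (forall u v, linear (fun z => F z u v)) -> linear (fun z => tlift (F z) t).
Proof.
move=> lF a x y; rewrite /tlift scaler_sumr -big_split /=.
by apply: eq_bigr => p _; rewrite lF.
Qed.

End Tensor.

Notation "U ⊗ V" := (tens U V) (at level 40, left associativity) : type_scope.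
Notation "u ⊗ v" := (tpure u v) (at level 40, left associativity) : ring_scope.

Definition tmap (k : fieldType) (U V U' V' : lmodType k)
    (f : U -> U') (g : V -> V') : (U ⊗ V)%type -> (U' ⊗ V')%type :=
  tlift (fun u v => f u ⊗ g v).

(* The structure maps of a Hopf quasigroup, without axioms. *)
Record hqStruct (k : fieldType) := HQStruct {
  hq_sort :> lmodType k;
  hq_mul : {linear (hq_sort ⊗ hq_sort)%type -> hq_sort};
  hq_unit : {linear k^o -> hq_sort};
  hq_comul : {linear hq_sort -> (hq_sort ⊗ hq_sort)%type};
  hq_counit : {linear hq_sort -> k^o};
  hq_antipode : {linear hq_sort -> hq_sort}
}.

Section Operations.
Context (k : fieldType) (H : hqStruct k).

Definition hmul (h g : H) : H := hq_mul H (h ⊗ g).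
Definition hone : H := hq_unit H (1 : k^o).
Definition heps (h : H) : k := hq_counit H h.

(* Integer powers of the antipode. Negative powers are those of its inverse   *)
(* function; they are only used when the antipode is bijective.               *)
Definition Spow (m : int) : H -> H :=
  match m with
  | Posz n => iter n (hq_antipode H)
  | Negz n => iter n.+1 ('pinv_(fun=> 0) [set: H] (hq_antipode H))
  end.

(* Sweedler sums: [sw2 F h] is F h_(1) h_(2) and [sw3 F h] is                 *)
(* F h_(1) h_(2) h_(3), where F is multilinear.                               *)
Definition sw2 (W : lmodType k) (F : H -> H -> W) (h : H) : W :=
  tlift F (hq_comul H h).
Definition sw3 (W : lmodType k) (F : H -> H -> H -> W) (h : H) : W :=
  sw2 (fun h1 h' => sw2 (F h1) h') h.

End Operations.

Arguments hone {k}.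
Arguments Spow {k H}.

Notation "h ∙ g" := (hmul h g) (at level 40, left associativity) : ring_scope.
Notation "'Δ'" := (hq_comul _) : ring_scope.
Notation "'ε'" := (@heps _ _) : ring_scope.
Notation "'𝕊'" := (hq_antipode _) : ring_scope.
Notation "\sw_ ( h1 , h2 <- h ) E" := (sw2 (fun h1 h2 => E) h)
  (at level 41, E at level 41, h1 name, h2 name,
   format "\sw_ ( h1 ,  h2  <-  h )  E") : ring_scope.
Notation "\sw_ ( h1 , h2 , h3 <- h ) E" := (sw3 (fun h1 h2 h3 => E) h)
  (at level 41, E at level 41, h1 name, h2 name, h3 name,
   format "\sw_ ( h1 ,  h2 ,  h3  <-  h )  E") : ring_scope.

Section HopfQuasigroup.
Context (k : fieldType).

Definition unital_algebra (H : hqStruct k) : Prop :=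
  forall h : H, hone H ∙ h = h /\ h ∙ hone H = h.

Definition counital_coalgebra (H : hqStruct k) : Prop :=
  [/\ (forall h : H,
        \sw_(x, h3 <- h) (\sw_(h1, h2 <- x) (h1 ⊗ (h2 ⊗ h3)))
        = \sw_(h1, x <- h) (\sw_(h2, h3 <- x) (h1 ⊗ (h2 ⊗ h3)))),
      (forall h : H, \sw_(h1, h2 <- h) (ε h1 *: h2) = h)
    & (forall h : H, \sw_(h1, h2 <- h) (ε h2 *: h1) = h)].

Definition multiplicative_coalgebra (H : hqStruct k) : Prop :=
  forall h g : H,
    Δ (h ∙ g) = \sw_(h1, h2 <- h) (\sw_(g1, g2 <- g) ((h1 ∙ g1) ⊗ (h2 ∙ g2)))
    /\ ε (h ∙ g) = ε h * ε g.

Definition coalgebra_antiautomorphism (H : hqStruct k) (T : H -> H) : Prop :=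
  [/\ bijective T,
      (forall h, Δ (T h) = \sw_(h1, h2 <- h) (T h2 ⊗ T h1))
    & (forall h, ε (T h) = ε h)].

Definition antipode_identity (H : hqStruct k) (T : H -> H) : Prop :=
  forall h,
    \sw_(h1, h2 <- h) (h1 ∙ T h2) = ε h *: hone H
    /\ \sw_(h1, h2 <- h) (T h1 ∙ h2) = ε h *: hone H.

Record inverse_property_HQ (m : int) (H : hqStruct k) : Prop := InversePropertyHQ {
  ip_algebra : unital_algebra H;
  ip_coalgebra : counital_coalgebra H;
  ip_multiplicative : multiplicative_coalgebra H;
  ip_antiaut : coalgebra_antiautomorphism (hq_antipode H);
  ip_antipode : antipode_identity (hq_antipode H);
  ip_unique : forall T : {linear H -> H},
    coalgebra_antiautomorphism T -> antipode_identity T ->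
    forall h, T h = 𝕊 h;
  ip_inverse : forall h g : H,
    \sw_(h1, h2 <- h) (Spow m (h2 ∙ g) ∙ Spow (m + 1) h1) = ε h *: Spow m g
}.

Definition Spow_aut (r : int) (H : hqStruct k) : Prop :=
  forall h g : H,
    Spow r (h ∙ g) = Spow r h ∙ Spow r g
    /\ Δ (Spow r h) = \sw_(h1, h2 <- h) (Spow r h1 ⊗ Spow r h2).

Record HQ_morphism (H K : hqStruct k) (f : {linear H -> K}) : Prop := HQMorphism {
  morph_mul : forall h g, f (h ∙ g) = f h ∙ f g;
  morph_unit : forall c, f (hq_unit H c) = hq_unit K c;
  morph_comul : forall h, tmap f f (Δ h) = Δ (f h);
  morph_counit : forall h, ε (f h) = ε h;
  morph_antipode : forall h, f (𝕊 h) = 𝕊 (f h)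
}.

(* A quasi-subgroup is given with its inclusion map. That the structure maps  *)
(* of H are those of G restricted to H says that iota commutes with them.     *)
Definition quasi_subgroup (m : int) (G H : hqStruct k) (iota : {linear H -> G}) :
    Prop :=
  [/\ injective iota, HQ_morphism iota & inverse_property_HQ m H].

Definition HQ_isomorphic (H K : hqStruct k) : Prop :=
  exists f : {linear H -> K}, bijective f /\ HQ_morphism f.

End HopfQuasigroup.

Section MatchedPair.
Context (k : fieldType) (m : int) (H1 H2 : hqStruct k).
Context (phi : {linear (H2 ⊗ H1)%type -> H1}) (psi : {linear (H2 ⊗ H1)%type -> H2}).

Local Notation φ x y := (phi (x ⊗ y)).
Local Notation ψ x y := (psi (x ⊗ y)).

(* x, x1, ... range over H2 (h', h'_(1), ... in the usual notation);          *)
(* h, g, h1, g1, ... range over H1.                                           *)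
Record matched_pair : Prop := MatchedPair {
  mp_unit : forall (h : H1) (x : H2),
    [/\ φ (hone H2) h = h, φ x (hone H1) = ε x *: hone H1,
        ψ (hone H2) h = ε h *: hone H2 & ψ x (hone H1) = x];
  mp_phi_inv : forall (h : H1) (x : H2),
    \sw_(x1, x2 <- x) φ (𝕊 x1) (φ x2 h) = ε x *: h
    /\ \sw_(x1, x2 <- x) φ x1 (φ (𝕊 x2) h) = ε x *: h;
  mp_psi_ip : forall (h g : H1) (x : H2),
    \sw_(h1, h2 <- h) ψ (ψ x (Spow m (h2 ∙ g))) (Spow (m + 1) h1)
    = ε h *: ψ x (Spow m g);
  mp_psi_inv : forall (h : H1) (x : H2),
    \sw_(h1, h2 <- h) ψ (ψ x (𝕊 h1)) h2 = ε h *: x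
    /\ \sw_(h1, h2 <- h) ψ (ψ x h1) (𝕊 h2) = ε h *: x;
  mp_phi_coalg : forall (h : H1) (x : H2),
    Δ (φ x h) = \sw_(x1, x2 <- x) \sw_(h1, h2 <- h) (φ x1 h1 ⊗ φ x2 h2)
    /\ ε (φ x h) = ε h * ε x;
  mp_psi_coalg : forall (h : H1) (x : H2),
    Δ (ψ x h) = \sw_(x1, x2 <- x) \sw_(h1, h2 <- h) (ψ x1 h1 ⊗ ψ x2 h2)
    /\ ε (ψ x h) = ε h * ε x;
  mp_phi_ip : forall (h g : H1) (x : H2),
    ε h *: φ x (Spow m g) =
    if odd `|m|%N then
      \sw_(x1, x2 <- x) \sw_(h1, h2, h3 <- h) \sw_(g1, g2 <- g)
        (φ x1 (Spow m (h3 ∙ g2))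
         ∙ φ (ψ x2 (Spow m (h2 ∙ g1))) (Spow (m + 1) h1))
    else
      \sw_(x1, x2 <- x) \sw_(h1, h2, h3 <- h) \sw_(g1, g2 <- g)
        (φ x1 (Spow m (h2 ∙ g1))
         ∙ φ (ψ x2 (Spow m (h3 ∙ g2))) (Spow (m + 1) h1));
  mp_phi_antipode : forall (h : H1) (x : H2),
    \sw_(x1, x2 <- x) \sw_(h1, h2, h3 <- h)
      (φ x1 (𝕊 h2) ∙ φ (ψ x2 (𝕊 h1)) h3) = (ε h * ε x) *: hone H1
    /\ \sw_(x1, x2 <- x) \sw_(h1, h2, h3 <- h)
      (φ x1 h1 ∙ φ (ψ x2 h2) (𝕊 h3)) = (ε h * ε x) *: hone H1;
  mp_psi_antipode : forall (h : H1) (x : H2),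
    \sw_(x1, x2, x3 <- x) \sw_(h1, h2 <- h)
      (ψ (𝕊 x1) (φ x2 h1) ∙ ψ x3 h2) = (ε h * ε x) *: hone H2
    /\ \sw_(x1, x2, x3 <- x) \sw_(h1, h2 <- h)
      (ψ x1 (φ (𝕊 x3) h1) ∙ ψ (𝕊 x2) h2) = (ε h * ε x) *: hone H2;
  mp_compat : forall (h : H1) (x : H2),
    \sw_(x1, x2 <- x) \sw_(h1, h2 <- h) (ψ x1 h1 ⊗ φ x2 h2)
    = \sw_(x1, x2 <- x) \sw_(h1, h2 <- h) (ψ x2 h2 ⊗ φ x1 h1)
}.

Local Notation T := (H1 ⊗ H2)%type.

Definition bowtie_mul2 (h : H1) (x : H2) (g : H1) (y : H2) : T :=
  \sw_(x1, x2 <- x) \sw_(g1, g2 <- g) ((h ∙ φ x1 g1) ⊗ (ψ x2 g2 ∙ y)).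
Definition bowtie_mul : (T ⊗ T)%type -> T :=
  tlift (fun s t => tlift (fun h x => tlift (fun g y => bowtie_mul2 h x g y) t) s).
Definition bowtie_unit (c : k^o) : T := (c : k) *: (hone H1 ⊗ hone H2).
Definition bowtie_comul : T -> (T ⊗ T)%type :=
  tlift (fun h x =>
    \sw_(h1, h2 <- h) \sw_(x1, x2 <- x) ((h1 ⊗ x1) ⊗ (h2 ⊗ x2))).
Definition bowtie_counit : T -> k^o :=
  @tlift k H1 H2 k^o (fun h x => ε h * ε x).
Definition bowtie_antipode : T -> T :=
  tlift (fun h x =>
    \sw_(h1, h2 <- h) \sw_(x1, x2 <- x) (φ (𝕊 x2) (𝕊 h2) ⊗ ψ (𝕊 x1) (𝕊 h1))).

Section Linearity.
Context (Z W : lmodType k).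

Lemma sw2_linear (H : hqStruct k) (F : H -> H -> W) : bilin F -> linear (sw2 F).
Proof. by move=> bF a x y; rewrite /sw2 linearP tlift_linear. Qed.

Lemma sw2_linear_fun (H : hqStruct k) (F : Z -> H -> H -> W) h :
  (forall h1 h2, linear (fun z => F z h1 h2)) -> linear (fun z => sw2 (F z) h).
Proof. exact: tlift_linear_fun. Qed.

Lemma tpure_linearl (V V' : lmodType k) (f : Z -> V) (v : V') :
  linear f -> linear (fun z => f z ⊗ v).
Proof. by move=> lf a x y; rewrite lf (tpure_bilin V V').1. Qed.

Lemma tpure_linearr (V V' : lmodType k) (f : Z -> V) (v : V') :
  linear f -> linear (fun z => v ⊗ f z).
Proof. by move=> lf a x y; rewrite lf (tpure_bilin V' V).2. Qed.

Lemma hmul_linearl (H : hqStruct k) (f : Z -> H) g :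
  linear f -> linear (fun z => f z ∙ g).
Proof. by move=> lf a x y; rewrite /hmul (tpure_linearl g lf) linearP. Qed.

Lemma hmul_linearr (H : hqStruct k) (f : Z -> H) g :
  linear f -> linear (fun z => g ∙ f z).
Proof. by move=> lf a x y; rewrite /hmul (tpure_linearr g lf) linearP. Qed.

Lemma comp_linear (V V' : lmodType k) (f : Z -> V) (g : {linear V -> V'}) :
  linear f -> linear (fun z => g (f z)).
Proof. by move=> lf a x y; rewrite lf linearP. Qed.

Lemma id_linear : linear (fun z : Z => z).
Proof. by []. Qed.

End Linearity.

Ltac lin := repeat first
  [ exact: id_linear | exact: linearP
  | apply: tpure_linearl | apply: tpure_linearr
  | apply: hmul_linearl | apply: hmul_linearr | apply: comp_linear ].

Lemma bowtie_mul2_lin1 x g y : linear (fun h => bowtie_mul2 h x g y).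
Proof.
apply: sw2_linear_fun => x1 x2; apply: sw2_linear_fun => g1 g2.
by lin.
Qed.

Lemma bowtie_mul2_lin4 h x g : linear (fun y => bowtie_mul2 h x g y).
Proof.
apply: sw2_linear_fun => x1 x2; apply: sw2_linear_fun => g1 g2.
by lin.
Qed.

Lemma bowtie_mul2_lin2 h g y : linear (fun x => bowtie_mul2 h x g y).
Proof.
apply: sw2_linear; split=> [x2|x1]; apply: sw2_linear_fun => g1 g2; by lin.
Qed.

Lemma bowtie_mul2_lin3 h x y : linear (fun g => bowtie_mul2 h x g y).
Proof.
apply: sw2_linear_fun => x1 x2; apply: sw2_linear; split=> [g2|g1]; by lin.
Qed.

Lemma bowtie_mul2_bilinr h x : bilin (bowtie_mul2 h x).
Proof. by split=> ?; [exact: bowtie_mul2_lin3 | exact: bowtie_mul2_lin4]. Qed.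

Lemma bowtie_mul2_bilinl (t : T) : bilin (fun h x => tlift (bowtie_mul2 h x) t).
Proof.
by split=> ?; apply: tlift_linear_fun => ? ?;
   [exact: bowtie_mul2_lin1 | exact: bowtie_mul2_lin2].
Qed.

Lemma bowtie_mul_bilin :
  bilin (fun s t : T => tlift (fun h x => tlift (bowtie_mul2 h x) t) s).
Proof.
split=> [t|s]; first exact/tlift_linear/bowtie_mul2_bilinl.
by apply: tlift_linear_fun => h x; apply/tlift_linear/bowtie_mul2_bilinr.
Qed.

Lemma bowtie_mul_linear : linear bowtie_mul.
Proof. exact/tlift_linear/bowtie_mul_bilin. Qed.

Lemma bowtie_unit_linear : linear bowtie_unit.
Proof. by move=> a c d; rewrite /bowtie_unit scalerDl scalerA. Qed.

Lemma bowtie_comul_bilin : bilin (fun (h : H1) (x : H2) =>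
  \sw_(h1, h2 <- h) \sw_(x1, x2 <- x) ((h1 ⊗ x1) ⊗ (h2 ⊗ x2))).
Proof.
split=> [x|h].
- apply: sw2_linear; split=> [h2|h1]; apply: sw2_linear_fun => x1 x2; by lin.
- apply: sw2_linear_fun => h1 h2; apply: sw2_linear; split=> [x2|x1]; by lin.
Qed.

Lemma bowtie_comul_linear : linear bowtie_comul.
Proof. exact/tlift_linear/bowtie_comul_bilin. Qed.

Lemma bowtie_counit_bilin : @bilin k H1 H2 k^o (fun h x => ε h * ε x).
Proof.
split=> [x|h] a u v; rewrite /heps linearP.
- by rewrite mulrDl -[_ *: _]/(a * _) -mulrA.
- by rewrite mulrDr -[_ *: _]/(a * _) mulrCA.
Qed.

Lemma bowtie_counit_linear : linear bowtie_counit.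
Proof. exact/tlift_linear/bowtie_counit_bilin. Qed.

Lemma bowtie_antipode_bilin : bilin (fun (h : H1) (x : H2) =>
  \sw_(h1, h2 <- h) \sw_(x1, x2 <- x) (φ (𝕊 x2) (𝕊 h2) ⊗ ψ (𝕊 x1) (𝕊 h1))).
Proof.
split=> [x|h].
- apply: sw2_linear; split=> [h2|h1]; apply: sw2_linear_fun => x1 x2; by lin.
- apply: sw2_linear_fun => h1 h2; apply: sw2_linear; split=> [x2|x1]; by lin.
Qed.

Lemma bowtie_antipode_linear : linear bowtie_antipode.
Proof. exact/tlift_linear/bowtie_antipode_bilin. Qed.

HB.instance Definition _ :=
  GRing.isLinear.Build k _ _ _ bowtie_mul bowtie_mul_linear.
HB.instance Definition _ :=
  GRing.isLinear.Build k _ _ _ bowtie_unit bowtie_unit_linear.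
HB.instance Definition _ :=
  GRing.isLinear.Build k _ _ _ bowtie_comul bowtie_comul_linear.
HB.instance Definition _ :=
  GRing.isLinear.Build k _ _ _ bowtie_counit bowtie_counit_linear.
HB.instance Definition _ :=
  GRing.isLinear.Build k _ _ _ bowtie_antipode bowtie_antipode_linear.

Definition bowtie : hqStruct k :=
  @HQStruct k T bowtie_mul bowtie_unit bowtie_comul bowtie_counit bowtie_antipode.

Lemma bowtie_mulE (h g : H1) (x y : H2) :
  (h ⊗ x : bowtie) ∙ (g ⊗ y : bowtie) =
  \sw_(x1, x2 <- x) \sw_(g1, g2 <- g) ((h ∙ φ x1 g1) ⊗ (ψ x2 g2 ∙ y)).
Proof.
rewrite /hmul /= /bowtie_mul (tlift_pure bowtie_mul_bilin).
by rewrite (tlift_pure (bowtie_mul2_bilinl _)) (tlift_pure (bowtie_mul2_bilinr _ _)).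
Qed.

Lemma bowtie_comulE (h : H1) (x : H2) :
  hq_comul bowtie (h ⊗ x) =
  \sw_(h1, h2 <- h) \sw_(x1, x2 <- x) ((h1 ⊗ x1) ⊗ (h2 ⊗ x2)).
Proof. exact: (tlift_pure bowtie_comul_bilin). Qed.

Lemma bowtie_counitE (h : H1) (x : H2) :
  hq_counit bowtie (h ⊗ x) = ε h * ε x.
Proof. exact: (tlift_pure bowtie_counit_bilin). Qed.

Lemma bowtie_antipodeE (h : H1) (x : H2) :
  hq_antipode bowtie (h ⊗ x) =
  \sw_(h1, h2 <- h) \sw_(x1, x2 <- x) (φ (𝕊 x2) (𝕊 h2) ⊗ ψ (𝕊 x1) (𝕊 h1)).
Proof. exact: (tlift_pure bowtie_antipode_bilin). Qed.

End MatchedPair.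

(* Main.v *)
(* Write T = S^m, and let p1, p2 be the inverse of Theta followed by the two
   counits; then phi(x, h) = p1(x h) and psi(x, h) = p2(x h) for x in H2 and h
   in H1. Everything reduces to two associativity laws in G,
       (x y) c = x (y c)   and   (x c) h = x (c h),   x, y in H2, c, h in H1,
   whose p1- and p2-components are the usual matched pair identities (for
   instance phi(x y, c) = phi(x, phi(y, c))); the axioms of a matched pair
   follow from these by the antipode and inverse properties of H1 and H2.

   For m odd, the inverse property applied to T(h_2 g) and S T(h_1) gives
       T T(g_1) . S T T(h g_2) = eps(g) S T T(h)
   in G, H1 and H2. For h in H1 and b = g x in G the inverse property becomes
       (x . T(h_2 g)) . S T(h_1) = eps(h) x . T(g);
   substituting h = T T(b_1), g = S T T(d b_2) and using the first identity in
   H1 turns this into the second associativity law on the image of S T^3. The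
   first law is obtained similarly.

   For m even, T is multiplicative on products of H1 with H2, and the inverse
   property says h_2 (x S(h_1)) = eps(h) x and (x_2 h) S(x_1) = eps(x) h,
   which force psi and phi to be trivial. Thus H1 and H2 commute elementwise,
   and the two laws follow from the assumed ones. *)
Require Import Defs.
From HB Require Import structures.
From mathcomp Require Import all_boot all_order all_algebra.
From mathcomp Require Import boolp classical_sets functions.

Set Implicit Arguments.
Unset Strict Implicit.
Unset Printing Implicit Defensive.

Import GRing.Theory.
Local Open Scope ring_scope.

(** * Linear maps on tensor products *)

Section LinearFunctions.
Context (k : fieldType).

(** Bundles a map given by an expression, so that the general lemmas on linear maps apply to it. *)
Definition linear_pack (U V : lmodType k) (f : U -> V) (lf : linear f) :
    {linear U -> V} :=
  HB.pack f (GRing.isLinear.Build k U V *:%R f lf).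

Lemma pure_ind (U V W : lmodType k) (f g : (U ⊗ V)%type -> W) :
  linear f -> linear g -> (forall u v, f (u ⊗ v) = g (u ⊗ v)) -> f =1 g.
Proof.
move=> lf lg e t; pose f' := linear_pack lf; pose g' := linear_pack lg.
rewrite -[f t]/(f' t) -[g t]/(g' t) (tpure_sum t) !linear_sum.
by apply: eq_bigr => p _; exact: e.
Qed.

Lemma linear_inverse (U V : lmodType k) (f : {linear U -> V}) (g : V -> U) :
  cancel f g -> cancel g f -> linear g.
Proof. by move=> fK gK a x y; apply: (can_inj fK); rewrite linearP !gK. Qed.

End LinearFunctions.

(** * Calculus of Sweedler sums *)

Section SweedlerCalculus.
Context (k : fieldType).

Lemma eq_sw2 (H : hqStruct k) (W : lmodType k) (F F' : H -> H -> W) h :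
  (forall a b, F a b = F' a b) -> sw2 F h = sw2 F' h.
Proof. by move=> e; apply: eq_bigr => p _; exact: e. Qed.

(** Both sides are finite sums over chosen expressions of the two coproducts, so this is an
    interchange of summations. *)
Lemma sw2_exchange (H K : hqStruct k) (W : lmodType k)
    (F : H -> H -> K -> K -> W) h g :
  \sw_(a, b <- h) \sw_(c, d <- g) F a b c d =
  \sw_(c, d <- g) \sw_(a, b <- h) F a b c d.
Proof. exact: exchange_big. Qed.

Lemma linear_sw2 (H : hqStruct k) (V W : lmodType k) (f : {linear V -> W})
    (F : H -> H -> V) h :
  f (sw2 F h) = \sw_(a, b <- h) f (F a b).
Proof. exact: linear_sum. Qed.

Lemma scale_sw2 (H : hqStruct k) (W : lmodType k) c (F : H -> H -> W) h :
  c *: sw2 F h = \sw_(a, b <- h) (c *: F a b).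
Proof. exact: scaler_sumr. Qed.

Lemma scale_linear_fun (Z W : lmodType k) c (f : Z -> W) :
  linear f -> linear (fun z => c *: f z).
Proof. by move=> lf a x y; rewrite lf scalerDr !scalerA mulrC. Qed.

Lemma eps_linear_fun (H : hqStruct k) (Z W : lmodType k) (f : Z -> H) (w : W) :
  linear f -> linear (fun z => ε (f z) *: w).
Proof. by move=> lf a x y; rewrite lf /heps linearP scalerDl scalerA. Qed.

Lemma sw2_linear_arg (H : hqStruct k) (Z W : lmodType k) (F : H -> H -> W)
    (f : Z -> H) :
  linear f -> bilin F -> linear (fun z => sw2 F (f z)).
Proof. by move=> lf bF a x y; rewrite lf sw2_linear. Qed.

End SweedlerCalculus.

(** Proves linearity and bilinearity by descending through sums, scalars, counits, tensors and
    products to the variable. *)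
Ltac lin := repeat first
  [ exact: id_linear
  | split=> ?
  | apply: sw2_linear_fun => ? ? | apply: sw2_linear_arg
  | apply: scale_linear_fun | apply: eps_linear_fun
  | apply: tpure_linearl | apply: tpure_linearr
  | apply: hmul_linearl | apply: hmul_linearr
  | exact: linearP | apply: comp_linear ].

Section Tensors.
Context (k : fieldType) (U V : lmodType k).

Lemma tpureZl c (u : U) (v : V) : (c *: u) ⊗ v = c *: (u ⊗ v).
Proof. exact: (linearZ_LR (linear_pack (tpure_linearl v (@id_linear k U)))). Qed.

Lemma tpureZr c (u : U) (v : V) : u ⊗ (c *: v) = c *: (u ⊗ v).
Proof. exact: (linearZ_LR (linear_pack (tpure_linearr u (@id_linear k V)))). Qed.

End Tensors.

Section SweedlerTensors.
Context (k : fieldType) (H : hqStruct k) (U V : lmodType k).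

Lemma tpure_sw2l (F : H -> H -> U) h (v : V) :
  sw2 F h ⊗ v = \sw_(a, b <- h) (F a b ⊗ v).
Proof. exact: (linear_sw2 (linear_pack (tpure_linearl v (@id_linear k U)))). Qed.

Lemma tpure_sw2r (F : H -> H -> V) h (u : U) :
  u ⊗ sw2 F h = \sw_(a, b <- h) (u ⊗ F a b).
Proof. exact: (linear_sw2 (linear_pack (tpure_linearr u (@id_linear k V)))). Qed.

End SweedlerTensors.

Section Products.
Context (k : fieldType) (H : hqStruct k).

Lemma hmulZl (c : k) (h g : H) : (c *: h) ∙ g = c *: (h ∙ g).
Proof.
exact: (linearZ_LR (linear_pack (@hmul_linearl k H H id g (@id_linear k H)))).
Qed.

Lemma hmulZr (c : k) (h g : H) : h ∙ (c *: g) = c *: (h ∙ g).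
Proof.
exact: (linearZ_LR (linear_pack (@hmul_linearr k H H id h (@id_linear k H)))).
Qed.

Lemma sw2_hmull (K : hqStruct k) (F : K -> K -> H) x g :
  sw2 F x ∙ g = \sw_(a, b <- x) (F a b ∙ g).
Proof.
exact: (linear_sw2 (linear_pack (@hmul_linearl k H H id g (@id_linear k H)))).
Qed.

Lemma sw2_hmulr (K : hqStruct k) (F : K -> K -> H) x g :
  g ∙ sw2 F x = \sw_(a, b <- x) (g ∙ F a b).
Proof.
exact: (linear_sw2 (linear_pack (@hmul_linearr k H H id g (@id_linear k H)))).
Qed.

Lemma epsZ (c : k) (h : H) : ε (c *: h) = c * ε h.
Proof. by rewrite /heps linearZ. Qed.

End Products.

(** * Coalgebra maps and antimaps *)

Section CoalgebraMaps.
Context (k : fieldType).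

Definition coalgebra_map (H K : hqStruct k) (f : H -> K) : Prop :=
  (forall h, Δ (f h) = \sw_(a, b <- h) (f a ⊗ f b)) /\ (forall h, ε (f h) = ε h).

Definition coalgebra_antimap (H K : hqStruct k) (f : H -> K) : Prop :=
  (forall h, Δ (f h) = \sw_(a, b <- h) (f b ⊗ f a)) /\ (forall h, ε (f h) = ε h).

(** Bilinearity makes [tlift F] independent of the expression chosen for the coproduct of [x], so
    any known expression may replace it. *)
Lemma sw2_of_comul (H K : hqStruct k) (W : lmodType k) (F : K -> K -> W)
    (x : K) (E : H -> H -> (K ⊗ K)%type) h :
  bilin F -> Δ x = sw2 E h -> sw2 F x = \sw_(a, b <- h) tlift F (E a b).
Proof.
by move=> bF e; rewrite /sw2 e; exact: (linear_sw2 (linear_pack (tlift_linear bF))).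
Qed.

Lemma sw2_map (H K : hqStruct k) (W : lmodType k) (F : K -> K -> W) (f : H -> K) h :
  bilin F -> coalgebra_map f -> sw2 F (f h) = \sw_(a, b <- h) F (f a) (f b).
Proof.
move=> bF [e _]; rewrite (sw2_of_comul bF (e h)).
by apply: eq_sw2 => a b; rewrite tlift_pure.
Qed.

Lemma sw2_antimap (H K : hqStruct k) (W : lmodType k) (F : K -> K -> W)
    (f : H -> K) h :
  bilin F -> coalgebra_antimap f -> sw2 F (f h) = \sw_(a, b <- h) F (f b) (f a).
Proof.
move=> bF [e _]; rewrite (sw2_of_comul bF (e h)).
by apply: eq_sw2 => a b; rewrite tlift_pure.
Qed.

Lemma morph_coalgebra_map (H K : hqStruct k) (f : {linear H -> K}) :
  HQ_morphism f -> coalgebra_map f.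
Proof.
move=> mf; split=> h; last exact: morph_counit.
by rewrite -morph_comul.
Qed.

End CoalgebraMaps.

Section CoalgebraIdentities.
Context (k : fieldType) (H : hqStruct k).
Hypothesis coH : counital_coalgebra H.

Definition trilin (W : lmodType k) (F : H -> H -> H -> W) : Prop :=
  [/\ forall a, bilin (F a), forall b, bilin (fun a c => F a b c)
    & forall c, bilin (fun a b => F a b c)].

(** Coassociativity is assumed as an identity in $H \otimes (H \otimes H)$; a trilinear [F] factors
    through a linear map [L] on that space. *)
Lemma sw2_coassoc (W : lmodType k) (F : H -> H -> H -> W) h :
  trilin F ->
  \sw_(x, c <- h) \sw_(a, b <- x) F a b c = \sw_(a, x <- h) \sw_(b, c <- x) F a b c.
Proof.
case=> F1 F2 F3; have [coa _ _] := coH.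
have bF2 : bilin (fun a t => tlift (F a) t).
  split=> [t|a]; last exact: tlift_linear.
  by apply: tlift_linear_fun => u v; have [+ _] := F2 u; exact.
pose L := linear_pack (tlift_linear bF2).
have pureL a b c : F a b c = L (a ⊗ (b ⊗ c)).
  by rewrite /L /= tlift_pure // tlift_pure.
transitivity (L (\sw_(x, c <- h) (\sw_(a, b <- x) (a ⊗ (b ⊗ c))))).
  rewrite linear_sw2; apply: eq_sw2 => x c; rewrite linear_sw2.
  by apply: eq_sw2 => a b; exact: pureL.
rewrite coa linear_sw2; apply: eq_sw2 => a x; rewrite linear_sw2.
by apply: eq_sw2 => b c; rewrite -pureL.
Qed.

Lemma sw2_counitl (W : lmodType k) (f : H -> W) h :
  linear f -> \sw_(a, b <- h) (ε a *: f b) = f h.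
Proof.
have [_ e _] := coH => lf; pose f' := linear_pack lf.
rewrite -[in RHS](e h) -[RHS]/(f' _) linear_sw2.
by apply: eq_sw2 => a b; rewrite linearZ.
Qed.

Lemma sw2_counitr (W : lmodType k) (f : H -> W) h :
  linear f -> \sw_(a, b <- h) (ε b *: f a) = f h.
Proof.
have [_ _ e] := coH => lf; pose f' := linear_pack lf.
rewrite -[in RHS](e h) -[RHS]/(f' _) linear_sw2.
by apply: eq_sw2 => a b; rewrite linearZ.
Qed.

Hypothesis muH : multiplicative_coalgebra H.

Lemma sw2_hmul (W : lmodType k) (F : H -> H -> W) u v :
  bilin F ->
  sw2 F (u ∙ v) = \sw_(a, b <- u) \sw_(c, d <- v) F (a ∙ c) (b ∙ d).
Proof.
move=> bF; rewrite (sw2_of_comul bF (muH u v).1); apply: eq_sw2 => a b.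
rewrite -[LHS]/(linear_pack (tlift_linear bF) _) linear_sw2.
by apply: eq_sw2 => c d; rewrite /= tlift_pure.
Qed.

Lemma eps_hmul (u v : H) : ε (u ∙ v) = ε u * ε v.
Proof. exact: (muH u v).2. Qed.

(* Multiplicativity of the counit is not assumed to include [ε 1 = 1], which  *)
(* fails when [H = 0]; this is the form of it that always holds.              *)
Lemma eps_one (h : H) : unital_algebra H -> ε (hone H) *: h = h.
Proof.
move=> uH; rewrite -[in LHS](sw2_counitl (f := id) h) // scale_sw2.
rewrite -[RHS](sw2_counitl (f := id)) //.
by apply: eq_sw2 => a b; rewrite scalerA -eps_hmul (uH a).1.
Qed.

End CoalgebraIdentities.

(** * Integer powers of the antipode *)

Section AntipodePowers.
Context (k : fieldType) (H : hqStruct k).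

Lemma comul_sw2 (h : H) : \sw_(a, b <- h) (a ⊗ b) = Δ h.
Proof. by rewrite [RHS]tpure_sum. Qed.

(** The Boolean is the parity of a power of the antipode: odd powers reverse the coproduct. *)
Definition coalgebra_mapb (b : bool) (f : H -> H) : Prop :=
  if b then coalgebra_antimap f else coalgebra_map f.

Lemma coalgebra_antimap_comp b (f g : H -> H) :
  linear f -> coalgebra_antimap f -> coalgebra_mapb b g ->
  coalgebra_mapb (~~ b) (fun h => f (g h)).
Proof.
move=> lf [f2 f0]; pose f' := linear_pack lf.
case: b => -[g2 g0]; split=> [h|h]; rewrite ?f0 ?g0 //.
- have -> : Δ (f (g h)) = \sw_(a, b <- g h) (f' b ⊗ f' a) by exact: f2.
  by rewrite sw2_antimap //; lin.
- have -> : Δ (f (g h)) = \sw_(a, b <- g h) (f' b ⊗ f' a) by exact: f2.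
  by rewrite sw2_map //; lin.
Qed.

Lemma coalgebra_antimap_inverse (f : {linear H -> H}) (g : H -> H) :
  coalgebra_antimap f -> cancel f g -> cancel g f -> coalgebra_antimap g.
Proof.
move=> af fK gK; pose g' := linear_pack (linear_inverse fK gK).
split=> h; last by rewrite -[in RHS](gK h) af.2.
rewrite -[in RHS](gK h) -[RHS]/(\sw_(a, b <- f (g h)) (g' b ⊗ g' a)).
rewrite sw2_antimap //; last by lin.
by rewrite /= -comul_sw2; apply: eq_sw2 => a b; rewrite !fK.
Qed.

(** The function iterated in the negative branch of [Spow]. The default value 0 never occurs for a
    bijective antipode. *)
Definition Sinv : H -> H := 'pinv_(fun=> 0) [set: H] (hq_antipode H).

Hypothesis bS : bijective (hq_antipode H).

Lemma SK : cancel (hq_antipode H) Sinv.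
Proof. by move=> h; apply: pinvKV; [move=> ? ? _ _; exact: bij_inj | rewrite inE]. Qed.

Lemma SinvK : cancel Sinv (hq_antipode H).
Proof.
have [T _ TK] := bS; move=> h; apply: pinvK; rewrite inE.
by exists (T h) => //; exact: TK.
Qed.

Lemma Spow_ind (P : bool -> (H -> H) -> Prop) (m : int) :
  P false id ->
  (forall b f, P b f -> P (~~ b) (fun h => 𝕊 (f h))) ->
  (forall b f, P b f -> P (~~ b) (fun h => Sinv (f h))) ->
  P (odd `|m|%N) (Spow m).
Proof.
move=> P0 PS PV; case: m => n.
  by rewrite absz_nat; elim: n => [|n IH] //; rewrite oddS; exact: PS IH.
(* [Negz n] is $-(n+1)$, so there are [n.+1] factors [Sinv]. *)
suff PI l : P (odd l) (iter l Sinv) by exact: (PI n.+1).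
by elim: l => [|l IH] //; rewrite oddS; exact: PV IH.
Qed.

Lemma SpowS (m : int) h : Spow (m + 1) h = 𝕊 (Spow m h) :> H.
Proof.
case: m => [n|[|n]].
- by have -> : Posz n + 1 = n.+1 by rewrite -addn1 PoszD.
- by rewrite [Spow (Negz 0) h]/(Sinv h) SinvK.
- have -> : Negz n.+1 + 1 = Negz n by rewrite !NegzE -[in LHS]addn1 PoszD opprD addrNK.
  by rewrite [Spow (Negz n.+1) h]/(Sinv (iter n.+1 Sinv h)) SinvK.
Qed.

Hypothesis aS : coalgebra_antimap (hq_antipode H).

Lemma Spow_spec (m : int) : exists T : {linear H -> H},
  [/\ Spow m = T :> (H -> H), bijective T, coalgebra_mapb (odd `|m|%N) T
    & forall h, 𝕊 (T h) = T (𝕊 h)].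
Proof.
suff [lT [bT cT sT]] : linear (@Spow k H m) /\ [/\ bijective (@Spow k H m),
    coalgebra_mapb (odd `|m|%N) (@Spow k H m) & forall h : H, 𝕊 (Spow m h) = Spow m (𝕊 h)].
  by exists (linear_pack lT).
pose P b (f : H -> H) := linear f /\ [/\ bijective f, coalgebra_mapb b f
  & forall h : H, 𝕊 (f h) = f (𝕊 h)].
apply: (Spow_ind (P := P)) => [|b f [lf [bf cf sf]]|b f [lf [bf cf sf]]].
- split=> //; split=> //; first by exists id.
  by split=> // h; rewrite comul_sw2.
- split; first by apply: comp_linear.
  split=> [||h]; [exact: bij_comp|exact: coalgebra_antimap_comp (linearP _) aS cf|].
  by rewrite sf.
- have lV := linear_inverse SK SinvK.
  split; first exact: (comp_linear (linear_pack lV) lf).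
  split=> [||h]; [|exact: coalgebra_antimap_comp lV (coalgebra_antimap_inverse aS SK SinvK) cf|].
    by apply: (bij_comp (f := Sinv)) bf; exists (hq_antipode H); [exact: SinvK|exact: SK].
  by rewrite SinvK -sf SK.
Qed.

End AntipodePowers.

(** * Powers of the antipode reduced to their parity *)

Section Twists.
Context (k : fieldType).

Record antipodal_bialgebra (H : hqStruct k) : Prop := AntipodalBialgebra {
  ab_algebra : unital_algebra H;
  ab_coalgebra : counital_coalgebra H;
  ab_multiplicative : multiplicative_coalgebra H;
  ab_bij : bijective (hq_antipode H);
  ab_anti : coalgebra_antimap (hq_antipode H)
}.

(* A twist abstracts [T = S ^ m], with [b] the parity of [m]: [tw_ip] is the  *)
(* [m]-inverse property.                                                      *)
Record twist (b : bool) (H : hqStruct k) (T : H -> H) : Prop := Twist {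
  tw_bij : bijective T;
  tw_coalg : coalgebra_mapb b T;
  tw_antipode : forall h : H, 𝕊 (T h) = T (𝕊 h);
  tw_ip : forall h g : H,
    \sw_(h1, h2 <- h) (T (h2 ∙ g) ∙ 𝕊 (T h1)) = ε h *: T g
}.

Lemma inverse_property_antipodal m (H : hqStruct k) :
  inverse_property_HQ m H -> antipodal_bialgebra H.
Proof. by case=> ? ? ? [? ? ?] _ _ _; split. Qed.

Lemma Spow_twist m (H : hqStruct k) : inverse_property_HQ m H ->
  exists T : {linear H -> H}, Spow m = T :> (H -> H) /\ twist (odd `|m|%N) T.
Proof.
move=> ip; have [_ _ _ bS aS] := inverse_property_antipodal ip.
have [T [eT bT cT sT]] := Spow_spec bS aS m; exists T; split=> //; split=> // h g.
rewrite -eT -(ip_inverse ip); apply: eq_sw2 => a b.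
by rewrite (SpowS bS).
Qed.

End Twists.

Section OddTwist.
Context (k : fieldType) (H : hqStruct k) (T : {linear H -> H}).
Hypothesis abH : antipodal_bialgebra H.
Hypothesis twT : twist true T.

Let coH := ab_coalgebra abH.
Let muH := ab_multiplicative abH.
Let aT : coalgebra_antimap T := tw_coalg twT.
Let ST := tw_antipode twT.
Let ipT := tw_ip twT.

(* The inverse property applied to [T (h_2 g)] and [S (T h_1)]: since [T]     *)
(* reverses the coproduct, the factors that cancel are adjacent.              *)
Lemma odd_twist_inverse (h g : H) :
  \sw_(a, b <- g) (T (T a) ∙ 𝕊 (T (T (h ∙ b)))) = ε g *: 𝕊 (T (T h)).
Proof.
transitivity (\sw_(c, d <- h) \sw_(a, b <- T (d ∙ g)) (T (b ∙ 𝕊 (T c)) ∙ 𝕊 (T a))); last first.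
  transitivity (\sw_(c, d <- h) (ε d *: (ε g *: 𝕊 (T (T c))))); last first.
    by rewrite (sw2_counitr coH); lin.
  by apply: eq_sw2 => c d; rewrite ipT aT.2 (eps_hmul muH) scalerA -ST.
transitivity (\sw_(c, d <- h) \sw_(d1, d2 <- d) \sw_(a, b <- g)
    (T (T (d1 ∙ a) ∙ 𝕊 (T c)) ∙ 𝕊 (T (T (d2 ∙ b))))); last first.
  apply: eq_sw2 => c d; rewrite sw2_antimap //; last by lin.
  by rewrite (sw2_hmul muH) //; lin.
rewrite -(sw2_coassoc coH (F := fun c d1 d2 => \sw_(a, b <- g)
    (T (T (d1 ∙ a) ∙ 𝕊 (T c)) ∙ 𝕊 (T (T (d2 ∙ b)))))); last by lin.
transitivity (\sw_(c, d <- h) (ε c *: \sw_(a, b <- g) (T (T a) ∙ 𝕊 (T (T (d ∙ b)))))).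
  by rewrite (sw2_counitl coH); lin.
apply: eq_sw2 => c d; rewrite sw2_exchange scale_sw2; apply: eq_sw2 => a b.
by rewrite -sw2_hmull -linear_sw2 ipT linearZ hmulZl.
Qed.

Lemma odd_twist_coalgebra_map : coalgebra_map (fun h => 𝕊 (T h)).
Proof.
exact: (coalgebra_antimap_comp (b := true) (linearP _) (ab_anti abH) aT).
Qed.

Lemma odd_twist2_coalgebra_map : coalgebra_map (fun h => T (T h)).
Proof.
exact: (coalgebra_antimap_comp (b := true) (linearP _) aT aT).
Qed.

End OddTwist.

(** * The factorization of G and its two projections *)

Section Factorization.
Context (k : fieldType) (H1 H2 G : hqStruct k).
Context (iota1 : {linear H1 -> G}) (iota2 : {linear H2 -> G}).

(* [p1] and [p2] are the inverse of [Theta] followed by the two counits, and  *)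
(* [fa_ind] is the surjectivity of [Theta].                                   *)
Record factorization (p1 : {linear G -> H1}) (p2 : {linear G -> H2}) : Prop :=
  Factorization {
    fa_ab1 : antipodal_bialgebra H1;
    fa_ab2 : antipodal_bialgebra H2;
    fa_abG : antipodal_bialgebra G;
    fa_mor1 : HQ_morphism iota1;
    fa_mor2 : HQ_morphism iota2;
    fa_assoc_l : forall h x g,
      (iota1 h ∙ iota2 x) ∙ g = iota1 h ∙ (iota2 x ∙ g);
    fa_assoc_r : forall h x g,
      g ∙ (iota1 h ∙ iota2 x) = (g ∙ iota1 h) ∙ iota2 x;
    fa_S12 : forall h x, 𝕊 (iota1 h ∙ iota2 x) = iota2 (𝕊 x) ∙ iota1 (𝕊 h);
    fa_p1 : forall h x, p1 (iota1 h ∙ iota2 x) = ε x *: h;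
    fa_p2 : forall h x, p2 (iota1 h ∙ iota2 x) = ε h *: x;
    fa_ind : forall (W : lmodType k) (f g : G -> W), linear f -> linear g ->
      (forall h x, f (iota1 h ∙ iota2 x) = g (iota1 h ∙ iota2 x)) -> f =1 g
  }.

Context (p1 : {linear G -> H1}) (p2 : {linear G -> H2}).
Hypothesis fact : factorization p1 p2.

Let uH1 := ab_algebra (fa_ab1 fact).
Let uH2 := ab_algebra (fa_ab2 fact).
Let uG := ab_algebra (fa_abG fact).
Let coH1 := ab_coalgebra (fa_ab1 fact).
Let coH2 := ab_coalgebra (fa_ab2 fact).
Let muH1 := ab_multiplicative (fa_ab1 fact).
Let muH2 := ab_multiplicative (fa_ab2 fact).
Let muG := ab_multiplicative (fa_abG fact).
Let mor1 := fa_mor1 fact.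
Let mor2 := fa_mor2 fact.
Let assoc_l := fa_assoc_l fact.
Let assoc_r := fa_assoc_r fact.
Let p1E := fa_p1 fact.
Let p2E := fa_p2 fact.
Let G_ind := fa_ind fact.

Lemma iota1_one : iota1 (hone H1) = hone G.
Proof. exact: morph_unit. Qed.

Lemma iota2_one : iota2 (hone H2) = hone G.
Proof. exact: morph_unit. Qed.

Lemma sw2_prod12 (W : lmodType k) (F : G -> G -> W) h x : bilin F ->
  sw2 F (iota1 h ∙ iota2 x) =
  \sw_(a, b <- h) \sw_(c, d <- x) F (iota1 a ∙ iota2 c) (iota1 b ∙ iota2 d).
Proof.
case=> F1 F2.
have bF : bilin F by [].
(* [lin] cannot look inside the variable [F]; this and the next fact let linearity pass through
   it. *)
have lF1 v (Z : lmodType k) (f : Z -> G) : linear f -> linear (fun z => F (f z) v).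
  by move=> lf; exact: (comp_linear (linear_pack (F1 v)) lf).
have lF2 u (Z : lmodType k) (f : Z -> G) : linear f -> linear (fun z => F u (f z)).
  by move=> lf; exact: (comp_linear (linear_pack (F2 u)) lf).
rewrite (sw2_hmul muG) // (sw2_map _ _ (morph_coalgebra_map mor1)).
  apply: eq_sw2 => a b; rewrite (sw2_map _ _ (morph_coalgebra_map mor2)) //.
  by split=> ?; [apply: lF1|apply: lF2]; lin.
by split=> ?; apply: sw2_linear_fun => ? ?; [apply: lF1|apply: lF2]; lin.
Qed.

Lemma sw2_prod21 (W : lmodType k) (F : G -> G -> W) h x : bilin F ->
  sw2 F (iota2 x ∙ iota1 h) =
  \sw_(c, d <- x) \sw_(a, b <- h) F (iota2 c ∙ iota1 a) (iota2 d ∙ iota1 b).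
Proof.
case=> F1 F2.
have bF : bilin F by [].
have lF1 v (Z : lmodType k) (f : Z -> G) : linear f -> linear (fun z => F (f z) v).
  by move=> lf; exact: (comp_linear (linear_pack (F1 v)) lf).
have lF2 u (Z : lmodType k) (f : Z -> G) : linear f -> linear (fun z => F u (f z)).
  by move=> lf; exact: (comp_linear (linear_pack (F2 u)) lf).
rewrite (sw2_hmul muG) // (sw2_map _ _ (morph_coalgebra_map mor2)).
  apply: eq_sw2 => a b; rewrite (sw2_map _ _ (morph_coalgebra_map mor1)) //.
  by split=> ?; [apply: lF1|apply: lF2]; lin.
by split=> ?; apply: sw2_linear_fun => ? ?; [apply: lF1|apply: lF2]; lin.
Qed.

Lemma eps_prod12 h x : ε (iota1 h ∙ iota2 x) = ε h * ε x.
Proof. by rewrite (eps_hmul muG) (morph_counit mor1) (morph_counit mor2). Qed.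

Lemma eps_prod21 h x : ε (iota2 x ∙ iota1 h) = ε h * ε x.
Proof. by rewrite (eps_hmul muG) (morph_counit mor1) (morph_counit mor2) mulrC. Qed.

(** On $h_{(1)}x_{(1)} \otimes h_{(2)}x_{(2)}$ the map [p1] turns $x_{(1)}$ into its counit and [p2]
    does so with $h_{(2)}$. Thus $u \mapsto p_1(u_{(1)}) \otimes p_2(u_{(2)})$ is the inverse of
    Theta. *)
Lemma p12_prod h x : \sw_(a, b <- iota1 h ∙ iota2 x) (p1 a ⊗ p2 b) = h ⊗ x.
Proof.
rewrite sw2_prod12; last by lin.
transitivity (\sw_(a, b <- h) (ε b *: (a ⊗ x))); last by rewrite (sw2_counitr coH1); lin.
apply: eq_sw2 => a b; transitivity (\sw_(c, d <- x) (ε c *: (ε b *: (a ⊗ d)))).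
  apply: eq_sw2 => c d; rewrite p1E p2E.
  by rewrite tpureZl tpureZr.
by rewrite (sw2_counitl coH2); lin.
Qed.

Lemma p12_prod_bilin (W : lmodType k) (F : H1 -> H2 -> W) h x : bilin F ->
  \sw_(a, b <- iota1 h ∙ iota2 x) F (p1 a) (p2 b) = F h x.
Proof.
move=> bF; pose L := linear_pack (tlift_linear bF).
have LE c d : L (c ⊗ d) = F c d by rewrite /L /= tlift_pure.
rewrite -LE -p12_prod linear_sw2; apply: eq_sw2 => a b.
by rewrite LE.
Qed.

Lemma p21_prod h x : \sw_(a, b <- iota1 h ∙ iota2 x) (p1 b ⊗ p2 a) = h ⊗ x.
Proof.
rewrite sw2_prod12; last by lin.
transitivity (\sw_(a, b <- h) (ε a *: (b ⊗ x))); last by rewrite (sw2_counitl coH1); lin.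
apply: eq_sw2 => a b; transitivity (\sw_(c, d <- x) (ε d *: (ε a *: (b ⊗ c)))).
  apply: eq_sw2 => c d; rewrite p1E p2E.
  by rewrite tpureZl tpureZr.
by rewrite (sw2_counitr coH2); lin.
Qed.

(** Both sides invert Theta on products; this is the source of [mp_compat]. *)
Lemma p_swap u : \sw_(a, b <- u) (p1 a ⊗ p2 b) = \sw_(a, b <- u) (p1 b ⊗ p2 a).
Proof.
by apply: G_ind u => [||h x]; [lin..|rewrite p12_prod p21_prod].
Qed.

Lemma p_swap_bilin (W : lmodType k) (F : H1 -> H2 -> W) u : bilin F ->
  \sw_(a, b <- u) F (p1 a) (p2 b) = \sw_(a, b <- u) F (p1 b) (p2 a).
Proof.
move=> bF; pose L := linear_pack (tlift_linear bF).
transitivity (L (\sw_(a, b <- u) (p1 a ⊗ p2 b))).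
  by rewrite linear_sw2; apply: eq_sw2 => a b; rewrite /L /= tlift_pure.
by rewrite p_swap linear_sw2; apply: eq_sw2 => a b; rewrite /L /= tlift_pure.
Qed.

Lemma p_split u : \sw_(a, b <- u) (iota1 (p1 a) ∙ iota2 (p2 b)) = u.
Proof.
apply: (G_ind (f := fun u => \sw_(a, b <- u) (iota1 (p1 a) ∙ iota2 (p2 b))) (g := id)) u => [||h x];
  [by lin|by []|].
by rewrite (p12_prod_bilin (F := fun h x => iota1 h ∙ iota2 x)) //; lin.
Qed.

Lemma p_split_swap u : \sw_(a, b <- u) (iota1 (p1 b) ∙ iota2 (p2 a)) = u.
Proof.
rewrite -[RHS]p_split -(p_swap_bilin (F := fun h x => iota1 h ∙ iota2 x)) //.
by lin.
Qed.

Lemma p1_coalgebra_map : coalgebra_map p1.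
Proof.
split=> u.
  apply: (G_ind (f := fun u => Δ (p1 u))) u => [||h x]; [by lin..|].
  rewrite p1E sw2_prod12; last by lin.
  rewrite linearZ_LR -comul_sw2 scale_sw2; apply: eq_sw2 => a b.
  transitivity (\sw_(c, d <- x) (ε c *: (ε d *: (a ⊗ b)))); last first.
    apply: eq_sw2 => c d; rewrite !p1E.
    by rewrite tpureZl tpureZr.
  by rewrite (sw2_counitl coH2 (f := fun z => ε z *: (a ⊗ b))); lin.
apply: (G_ind (W := k^o) (f := fun u => ε (p1 u)) (g := fun u => ε u)) u => [||h x].
- by rewrite /heps; lin.
- by rewrite /heps; lin.
- by rewrite p1E epsZ eps_prod12 mulrC.
Qed.

Lemma p2_coalgebra_map : coalgebra_map p2.
Proof.
split=> u.
  apply: (G_ind (f := fun u => Δ (p2 u))) u => [||h x]; [by lin..|].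
  rewrite p2E sw2_prod12; last by lin.
  rewrite linearZ_LR -comul_sw2 scale_sw2 sw2_exchange; apply: eq_sw2 => c d.
  transitivity (\sw_(a, b <- h) (ε a *: (ε b *: (c ⊗ d)))); last first.
    apply: eq_sw2 => a b; rewrite !p2E.
    by rewrite tpureZl tpureZr.
  by rewrite (sw2_counitl coH1 (f := fun z => ε z *: (c ⊗ d))); lin.
apply: (G_ind (W := k^o) (f := fun u => ε (p2 u)) (g := fun u => ε u)) u => [||h x].
- by rewrite /heps; lin.
- by rewrite /heps; lin.
- by rewrite p2E epsZ eps_prod12.
Qed.

(** On $u = hx$ the assumed associativity gives $g(hx) = (gh)x$, which is again a product of the
    form defining [p1]. The next three lemmas follow in the same way, those on the right from $(hx)y
    = h(xy)$. *)
Lemma p1_mull g u : p1 (iota1 g ∙ u) = g ∙ p1 u.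
Proof.
apply: (G_ind (f := fun u => p1 (iota1 g ∙ u)) (g := fun u => g ∙ p1 u)) u => [||h x]; [by lin..|].
by rewrite assoc_r -(morph_mul mor1) !p1E hmulZr.
Qed.

Lemma p2_mull g u : p2 (iota1 g ∙ u) = ε g *: p2 u.
Proof.
apply: (G_ind (f := fun u => p2 (iota1 g ∙ u)) (g := fun u => ε g *: p2 u)) u => [||h x]; [by lin..|].
by rewrite assoc_r -(morph_mul mor1) !p2E (eps_hmul muH1) scalerA.
Qed.

Lemma p1_mulr y u : p1 (u ∙ iota2 y) = ε y *: p1 u.
Proof.
apply: (G_ind (f := fun u => p1 (u ∙ iota2 y)) (g := fun u => ε y *: p1 u)) u => [||h x]; [by lin..|].
by rewrite assoc_l -(morph_mul mor2) !p1E (eps_hmul muH2) mulrC scalerA.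
Qed.

Lemma p2_mulr y u : p2 (u ∙ iota2 y) = p2 u ∙ y.
Proof.
apply: (G_ind (f := fun u => p2 (u ∙ iota2 y)) (g := fun u => p2 u ∙ y)) u => [||h x]; [by lin..|].
by rewrite assoc_l -(morph_mul mor2) !p2E hmulZl.
Qed.

(** Both units are sent to the unit of G, so the counits of the units of H1 and H2 agree and
    [eps_one] applies. *)
Lemma eps_hone2 h : ε (hone H2) *: h = h :> H1.
Proof.
by rewrite -(morph_counit mor2) iota2_one -iota1_one (morph_counit mor1) (eps_one coH1).
Qed.

Lemma eps_hone1 x : ε (hone H1) *: x = x :> H2.
Proof.
by rewrite -(morph_counit mor1) iota1_one -iota2_one (morph_counit mor2) (eps_one coH2).
Qed.

Lemma p1_iota1 h : p1 (iota1 h) = h.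
Proof. by rewrite -[iota1 h](uG _).2 -iota2_one p1E eps_hone2. Qed.

Lemma p2_iota2 x : p2 (iota2 x) = x.
Proof. by rewrite -[iota2 x](uG _).1 -iota1_one p2E eps_hone1. Qed.

Lemma p2_iota1 h : p2 (iota1 h) = ε h *: hone H2.
Proof. by rewrite -[iota1 h](uG _).2 -iota2_one p2E. Qed.

Lemma p1_iota2 x : p1 (iota2 x) = ε x *: hone H1.
Proof. by rewrite -[iota2 x](uG _).1 -iota1_one p1E. Qed.

End Factorization.

(** * The two associativity laws between H1 and H2 *)

Section MixedAssociativity.
Context (k : fieldType) (H1 H2 G : hqStruct k).
Context (iota1 : {linear H1 -> G}) (iota2 : {linear H2 -> G}).
Context (p1 : {linear G -> H1}) (p2 : {linear G -> H2}).
Hypothesis fact : factorization iota1 iota2 p1 p2.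

(** Stands for $S^m$ on H1, H2 and G at once. Iterating the assumed rules for S on mixed products,
    an odd power reverses such products and an even one preserves them. *)
Record twisted_factorization (b : bool) (T1 : H1 -> H1) (T2 : H2 -> H2)
    (T : G -> G) : Prop := TwistedFactorization {
  tf_twist1 : twist b T1;
  tf_twist2 : twist b T2;
  tf_twist : twist b T;
  tf_iota1 : forall h, iota1 (T1 h) = T (iota1 h);
  tf_iota2 : forall x, iota2 (T2 x) = T (iota2 x);
  tf_12 : forall h x, T (iota1 h ∙ iota2 x) =
    if b then iota2 (T2 x) ∙ iota1 (T1 h) else iota1 (T1 h) ∙ iota2 (T2 x);
  tf_21 : forall h x, T (iota2 x ∙ iota1 h) =
    if b then iota1 (T1 h) ∙ iota2 (T2 x) else iota2 (T2 x) ∙ iota1 (T1 h)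
}.

Context (T1 : {linear H1 -> H1}) (T2 : {linear H2 -> H2}) (T : {linear G -> G}).

Let ab1 := fa_ab1 fact.
Let ab2 := fa_ab2 fact.
Let uG := ab_algebra (fa_abG fact).
Let coH1 := ab_coalgebra ab1.
Let coH2 := ab_coalgebra ab2.
Let bS1 := ab_bij ab1.
Let bS2 := ab_bij ab2.
Let mor1 := fa_mor1 fact.
Let mor2 := fa_mor2 fact.
Let assoc_l := fa_assoc_l fact.
Let assoc_r := fa_assoc_r fact.
Let SK1 h : iota1 (𝕊 h) = 𝕊 (iota1 h). Proof. exact: morph_antipode. Qed.
Let SK2 x : iota2 (𝕊 x) = 𝕊 (iota2 x). Proof. exact: morph_antipode. Qed.

(** * Associativity for odd m *)

Section Odd.
Hypothesis tf : twisted_factorization true T1 T2 T.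

Let tw1 := tf_twist1 tf.
Let tw2 := tf_twist2 tf.
Let TK1 := tf_iota1 tf.
Let TK2 := tf_iota2 tf.
Let T12 : forall h x, T (iota1 h ∙ iota2 x) = iota2 (T2 x) ∙ iota1 (T1 h) := tf_12 tf.
Let T21 : forall h x, T (iota2 x ∙ iota1 h) = iota1 (T1 h) ∙ iota2 (T2 x) := tf_21 tf.
Let bT1 := tw_bij tw1.
Let bT2 := tw_bij tw2.
Let ST1 := tw_antipode tw1.
Let ST2 := tw_antipode tw2.
Let ip2 := tw_ip tw2.
Let ipG := tw_ip (tf_twist tf).
Let S12 := fa_S12 fact.

(** This is the inverse property of G at [h] and $gy$ with $x = T(y)$: [T] reverses the product
    $(h_{(2)}g)y$. *)
Lemma odd_right_inverse (h g : H1) (x : H2) :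
  \sw_(a, b <- h) ((iota2 x ∙ iota1 (T1 (b ∙ g))) ∙ iota1 (𝕊 (T1 a))) =
  ε h *: (iota2 x ∙ iota1 (T1 g)).
Proof.
have [V _ VK] := bT2; rewrite -[x]VK; move: (V x) => y.
have := ipG (iota1 h) (iota1 g ∙ iota2 y).
rewrite (sw2_map _ _ (morph_coalgebra_map mor1)); last by lin.
rewrite T12 (morph_counit mor1) => <-; apply: eq_sw2 => a b.
by rewrite assoc_r -(morph_mul mor1) T12 SK1 !TK1.
Qed.

Lemma odd_left_inverse (c : H1) (x y : H2) :
  \sw_(a, b <- x) (iota2 (T2 (T2 a)) ∙ (iota2 (𝕊 (T2 (T2 (y ∙ b)))) ∙ iota1 c)) =
  ε x *: (iota2 (𝕊 (T2 (T2 y))) ∙ iota1 c).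
Proof.
have [V _ VK] := bT1; have [V' _ VK'] := bS1.
(* Every [c] is $S T T(d)$, the H1-factor produced by applying $S T T$ to $dz$; [odd_twist_inverse]
   in G is then used at $dy$ and [x]. *)
rewrite -[c]VK' -[V' c]VK -[V _]VK; move: (V _) => d.
have STT z : 𝕊 (T (T (iota1 d ∙ iota2 z))) =
    iota2 (𝕊 (T2 (T2 z))) ∙ iota1 (𝕊 (T1 (T1 d))).
  by rewrite T12 T21 S12.
have := odd_twist_inverse (fa_abG fact) (tf_twist tf) (iota1 d ∙ iota2 y) (iota2 x).
rewrite (sw2_map _ _ (morph_coalgebra_map mor2)); last by lin.
rewrite STT (morph_counit mor2) => <-; apply: eq_sw2 => a b.
by rewrite assoc_l -(morph_mul mor2) STT !TK2.
Qed.

(** The associativity laws first appear for arguments of the form $S T^3$; these exhaust H1 and H2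
    because S and T are bijective. *)
Let U1 h := 𝕊 (T1 (T1 (T1 h))).
Let U2 x := 𝕊 (T2 (T2 (T2 x))).

(* The left-hand side of [odd_right_inverse] at [T T b_1] and                 *)
(* [S T T (d b_2)], where [odd_twist_inverse] can be applied once more.       *)
Let odd_assoc_U1 (d b : H1) (x : H2) :
  (iota2 x ∙ iota1 (U1 d)) ∙ iota1 (U1 b) = iota2 x ∙ iota1 (U1 (d ∙ b)).
Proof.
have aTT := odd_twist2_coalgebra_map tw1.
transitivity (\sw_(b1, b2 <- b) \sw_(c, e <- T1 (T1 b1))
    ((iota2 x ∙ iota1 (T1 (e ∙ 𝕊 (T1 (T1 (d ∙ b2)))))) ∙ iota1 (𝕊 (T1 c)))).
  transitivity (\sw_(b1, b2 <- b) \sw_(c, e <- b1)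
    ((iota2 x ∙ iota1 (T1 (T1 (T1 e) ∙ 𝕊 (T1 (T1 (d ∙ b2)))))) ∙ iota1 (U1 c))); last first.
    apply: eq_sw2 => b1 b2.
    by rewrite (sw2_map (f := fun h => T1 (T1 h))) //; lin.
  rewrite (sw2_coassoc coH1 (F := fun c e b2 =>
    (iota2 x ∙ iota1 (T1 (T1 (T1 e) ∙ 𝕊 (T1 (T1 (d ∙ b2)))))) ∙ iota1 (U1 c))).
    transitivity (\sw_(c, y <- b) (ε y *: ((iota2 x ∙ iota1 (U1 d)) ∙ iota1 (U1 c)))).
      by rewrite (sw2_counitr coH1) // /U1; lin.
    apply: eq_sw2 => c y; rewrite -sw2_hmull -sw2_hmulr -2!linear_sw2.
    by rewrite (odd_twist_inverse ab1 tw1) !linearZ /= hmulZr hmulZl -ST1.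
  by rewrite /U1; lin.
transitivity (\sw_(b1, b2 <- b) (ε b1 *: (iota2 x ∙ iota1 (T1 (𝕊 (T1 (T1 (d ∙ b2)))))))).
  by apply: eq_sw2 => b1 b2; rewrite odd_right_inverse aTT.2.
by rewrite (sw2_counitl coH1) ?/U1 ?ST1 //; lin.
Qed.

Let U1_surj c : exists d, c = U1 d.
Proof.
have [V _ VK] := bT1; have [V' _ VK'] := bS1.
by exists (V (V (V (V' c)))); rewrite /U1 !VK VK'.
Qed.

Let U2_surj c : exists d, c = U2 d.
Proof.
have [V _ VK] := bT2; have [V' _ VK'] := bS2.
by exists (V (V (V (V' c)))); rewrite /U2 !VK VK'.
Qed.

Lemma odd_assoc_right (c h : H1) (x : H2) :
  (iota2 x ∙ iota1 c) ∙ iota1 h = iota2 x ∙ iota1 (c ∙ h).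
Proof.
have [d ->] := U1_surj c; have [b ->] := U1_surj h; rewrite odd_assoc_U1.
(* At $x = 1$ the same identity says that [U1] is multiplicative. *)
have := odd_assoc_U1 d b (hone H2).
rewrite (iota2_one fact) !(uG _).1 => <-.
by rewrite (morph_mul mor1).
Qed.

(** Apply [odd_left_inverse] at $S T(a_{(1)})$ and $T(a_{(2)}b)$. After coassociativity the inverse
    property of H2 collapses the inner product to $T(b)$. *)
Let odd_assoc_U2 (a b : H2) (c : H1) :
  iota2 (U2 a) ∙ (iota2 (U2 b) ∙ iota1 c) = iota2 (U2 (a ∙ b)) ∙ iota1 c.
Proof.
have aST := odd_twist_coalgebra_map ab2 tw2.
transitivity (\sw_(a1, a2 <- a) \sw_(p, q <- 𝕊 (T2 a1))
  (iota2 (T2 (T2 p)) ∙ (iota2 (𝕊 (T2 (T2 (T2 (a2 ∙ b) ∙ q)))) ∙ iota1 c))).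
  transitivity (\sw_(a1, a2 <- a) \sw_(p, q <- a1)
    (iota2 (U2 p) ∙ (iota2 (𝕊 (T2 (T2 (T2 (a2 ∙ b) ∙ 𝕊 (T2 q))))) ∙ iota1 c))); last first.
    apply: eq_sw2 => a1 a2.
    rewrite (sw2_map (f := fun h => 𝕊 (T2 h))) //; last by lin.
    by apply: eq_sw2 => p q; rewrite /U2 !ST2.
  rewrite (sw2_coassoc coH2 (F := fun p q a2 =>
    iota2 (U2 p) ∙ (iota2 (𝕊 (T2 (T2 (T2 (a2 ∙ b) ∙ 𝕊 (T2 q))))) ∙ iota1 c))).
    transitivity (\sw_(p, y <- a) (ε y *: (iota2 (U2 p) ∙ (iota2 (U2 b) ∙ iota1 c)))).
      by rewrite (sw2_counitr coH2) // /U2; lin.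
    apply: eq_sw2 => p y; rewrite -sw2_hmulr -sw2_hmull -4!linear_sw2.
    by rewrite ip2 !linearZ /= hmulZl hmulZr.
  by rewrite /U2; lin.
transitivity (\sw_(a1, a2 <- a) (ε a1 *: (iota2 (U2 (a2 ∙ b)) ∙ iota1 c))).
  by apply: eq_sw2 => a1 a2; rewrite odd_left_inverse aST.2.
by rewrite (sw2_counitl coH2) // /U2; lin.
Qed.

Lemma odd_assoc_left (x y : H2) (c : H1) :
  iota2 x ∙ (iota2 y ∙ iota1 c) = iota2 (x ∙ y) ∙ iota1 c.
Proof.
have [a ->] := U2_surj x; have [b ->] := U2_surj y; rewrite odd_assoc_U2.
have := odd_assoc_U2 a b (hone H1).
rewrite (iota1_one fact) !(uG _).2 => <-.
by rewrite (morph_mul mor2).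
Qed.

End Odd.

(** * Associativity for even m, where the actions are trivial *)

Section Even.
Hypothesis tf : twisted_factorization false T1 T2 T.

Let TK1 := tf_iota1 tf.
Let TK2 := tf_iota2 tf.
Let T12 : forall h x, T (iota1 h ∙ iota2 x) = iota1 (T1 h) ∙ iota2 (T2 x) := tf_12 tf.
Let T21 : forall h x, T (iota2 x ∙ iota1 h) = iota2 (T2 x) ∙ iota1 (T1 h) := tf_21 tf.
Let bT1 := tw_bij (tf_twist1 tf).
Let bT2 := tw_bij (tf_twist2 tf).
Let cT1 : coalgebra_map T1 := tw_coalg (tf_twist1 tf).
Let cT2 : coalgebra_map T2 := tw_coalg (tf_twist2 tf).
Let ipG := tw_ip (tf_twist tf).

(** The inverse property of G with [T] distributed over $h_{(2)}x$; bijectivity lets $T(h)$ and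
    $T(x)$ be arbitrary elements. *)
Lemma even_inverse1 (h : H1) (x : H2) :
  \sw_(a, b <- h) (iota1 b ∙ (iota2 x ∙ iota1 (𝕊 a))) = ε h *: iota2 x.
Proof.
have [V _ VK] := bT2; have [V' _ VK'] := bT1.
rewrite -[x]VK -[h]VK'; move: (V x) (V' h) => y g.
rewrite sw2_map //; last by lin.
have := ipG (iota1 g) (iota2 y).
rewrite (sw2_map _ _ (morph_coalgebra_map mor1)); last by lin.
rewrite cT1.2 TK2 (morph_counit mor1) => <-; apply: eq_sw2 => a b.
by rewrite T12 assoc_l SK1 !TK1 !TK2.
Qed.

Lemma even_inverse2 (h : H1) (x : H2) :
  \sw_(a, b <- x) ((iota2 b ∙ iota1 h) ∙ iota2 (𝕊 a)) = ε x *: iota1 h.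
Proof.
have [V _ VK] := bT2; have [V' _ VK'] := bT1.
rewrite -[x]VK -[h]VK'; move: (V x) (V' h) => y g.
rewrite sw2_map //; last by lin.
have := ipG (iota2 y) (iota1 g).
rewrite (sw2_map _ _ (morph_coalgebra_map mor2)); last by lin.
rewrite cT2.2 TK1 (morph_counit mor2) => <-; apply: eq_sw2 => a b.
by rewrite T21 SK2 !TK1 !TK2.
Qed.

(** Under [p2] the left factor in [even_inverse1] becomes its counit, leaving $p_2(x S(g))$; every
    [h] is some $S(g)$. *)
Let even_p2 (h : H1) (x : H2) : p2 (iota2 x ∙ iota1 h) = ε h *: x.
Proof.
have [V _ VK] := bS1; rewrite -[h]VK (ab_anti ab1).2; move: (V h) => g.
have := congr1 p2 (even_inverse1 g x).
rewrite linear_sw2 linearZ /= (p2_iota2 fact) => <-.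
transitivity (\sw_(a, b <- g) (ε b *: p2 (iota2 x ∙ iota1 (𝕊 a)))).
  by rewrite (sw2_counitr coH1); lin.
by apply: eq_sw2 => a b; rewrite (p2_mull fact).
Qed.

Let even_p1 (h : H1) (x : H2) : p1 (iota2 x ∙ iota1 h) = ε x *: h.
Proof.
have e (y : H2) : iota2 y ∙ iota1 h =
    \sw_(c, d <- y) (iota1 (p1 (iota2 d ∙ iota1 h)) ∙ iota2 c).
  rewrite -[LHS](p_split_swap fact) (sw2_prod21 fact); last by lin.
  apply: eq_sw2 => c d; transitivity (\sw_(a, b <- h)
      (ε a *: (iota1 (p1 (iota2 d ∙ iota1 b)) ∙ iota2 c))).
    by apply: eq_sw2 => a b; rewrite even_p2 linearZ /= hmulZr.
  by rewrite (sw2_counitl coH1); lin.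
have := congr1 p1 (even_inverse2 h x).
rewrite linear_sw2 linearZ /= (p1_iota1 fact) => <-.
transitivity (\sw_(a, b <- x) (ε a *: p1 (iota2 b ∙ iota1 h))).
  by rewrite (sw2_counitl coH2); lin.
by apply: eq_sw2 => a b; rewrite (p1_mulr fact) (ab_anti ab2).2.
Qed.

Lemma even_commute (h : H1) (x : H2) : iota2 x ∙ iota1 h = iota1 h ∙ iota2 x.
Proof.
rewrite -[LHS](p_split fact) (sw2_prod21 fact); last by lin.
transitivity (\sw_(c, d <- x) (ε c *: (iota1 h ∙ iota2 d))).
  apply: eq_sw2 => c d; transitivity (\sw_(a, b <- h)
      (ε b *: (ε c *: (iota1 a ∙ iota2 d)))).
    by apply: eq_sw2 => a b; rewrite even_p1 even_p2 !linearZ /= hmulZl hmulZr scalerA mulrC -scalerA.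
  by rewrite (sw2_counitr coH1); lin.
by rewrite (sw2_counitl coH2); lin.
Qed.

(** Commuting moves the factor from H2 to the right, where the assumed laws apply. *)
Lemma even_assoc_right (c h : H1) (x : H2) :
  (iota2 x ∙ iota1 c) ∙ iota1 h = iota2 x ∙ iota1 (c ∙ h).
Proof.
by rewrite !even_commute assoc_l even_commute assoc_r (morph_mul mor1).
Qed.

Lemma even_assoc_left (x y : H2) (c : H1) :
  iota2 x ∙ (iota2 y ∙ iota1 c) = iota2 (x ∙ y) ∙ iota1 c.
Proof.
by rewrite !even_commute assoc_r even_commute assoc_l (morph_mul mor2).
Qed.

End Even.

Lemma mixed_assoc_right b (c h : H1) (x : H2) :
  twisted_factorization b T1 T2 T ->
  (iota2 x ∙ iota1 c) ∙ iota1 h = iota2 x ∙ iota1 (c ∙ h).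
Proof. by case: b => tf; [exact: odd_assoc_right|exact: even_assoc_right]. Qed.

Lemma mixed_assoc_left b (x y : H2) (c : H1) :
  twisted_factorization b T1 T2 T ->
  iota2 x ∙ (iota2 y ∙ iota1 c) = iota2 (x ∙ y) ∙ iota1 c.
Proof. by case: b => tf; [exact: odd_assoc_left|exact: even_assoc_left]. Qed.

End MixedAssociativity.

(** * The matched pair and the isomorphism with its bicrossed product *)

Section MatchedPairOfFactorization.
Context (k : fieldType) (H1 H2 G : hqStruct k).
Context (iota1 : {linear H1 -> G}) (iota2 : {linear H2 -> G}).
Context (p1 : {linear G -> H1}) (p2 : {linear G -> H2}).
Hypothesis fact : factorization iota1 iota2 p1 p2.

Let uG := ab_algebra (fa_abG fact).
Let coH1 := ab_coalgebra (fa_ab1 fact).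
Let muH1 := ab_multiplicative (fa_ab1 fact).
Let aS1 := ab_anti (fa_ab1 fact).
Let aS2 := ab_anti (fa_ab2 fact).
Let mor1 := fa_mor1 fact.
Let mor2 := fa_mor2 fact.
Let assoc_l := fa_assoc_l fact.
Let assoc_r := fa_assoc_r fact.

(** For $u = gy$ the factor [g] can be pulled out of [p1], which leaves [y] acting on [h]. This
    lemma and the next three express components of products in G through the two actions. *)
Lemma p1_prod_iota1 u h :
  p1 (u ∙ iota1 h) = \sw_(a, b <- u) (p1 a ∙ p1 (iota2 (p2 b) ∙ iota1 h)).
Proof.
apply: (fa_ind fact (f := fun u => p1 (u ∙ iota1 h))
  (g := fun u => \sw_(a, b <- u) (p1 a ∙ p1 (iota2 (p2 b) ∙ iota1 h)))) u => [||g y];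
  [by lin..|].
rewrite (p12_prod_bilin fact (F := fun c d => c ∙ p1 (iota2 d ∙ iota1 h))); last by lin.
by rewrite assoc_l (p1_mull fact).
Qed.

Lemma p2_prod_iota1 u h : p2 (u ∙ iota1 h) = p2 (iota2 (p2 u) ∙ iota1 h).
Proof.
apply: (fa_ind fact (f := fun u => p2 (u ∙ iota1 h))
  (g := fun u => p2 (iota2 (p2 u) ∙ iota1 h))) u => [||g y]; [by lin..|].
by rewrite assoc_l (p2_mull fact) (fa_p2 fact) linearZ_LR hmulZl linearZ_LR.
Qed.

Lemma p1_iota2_prod u x : p1 (iota2 x ∙ u) = p1 (iota2 x ∙ iota1 (p1 u)).
Proof.
apply: (fa_ind fact (f := fun u => p1 (iota2 x ∙ u))
  (g := fun u => p1 (iota2 x ∙ iota1 (p1 u)))) u => [||g y]; [by lin..|].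
by rewrite assoc_r (p1_mulr fact) (fa_p1 fact) linearZ_LR hmulZr linearZ_LR.
Qed.

Lemma p2_iota2_prod u x :
  p2 (iota2 x ∙ u) = \sw_(a, b <- u) (p2 (iota2 x ∙ iota1 (p1 a)) ∙ p2 b).
Proof.
apply: (fa_ind fact (f := fun u => p2 (iota2 x ∙ u))
  (g := fun u => \sw_(a, b <- u) (p2 (iota2 x ∙ iota1 (p1 a)) ∙ p2 b))) u => [||g y];
  [by lin..|].
rewrite (p12_prod_bilin fact (F := fun c d => p2 (iota2 x ∙ iota1 c) ∙ d)); last by lin.
by rewrite assoc_r (p2_mulr fact).
Qed.

Context (phi : {linear (H2 ⊗ H1)%type -> H1}) (psi : {linear (H2 ⊗ H1)%type -> H2}).
Hypothesis phiE : forall x h, phi (x ⊗ h) = p1 (iota2 x ∙ iota1 h).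
Hypothesis psiE : forall x h, psi (x ⊗ h) = p2 (iota2 x ∙ iota1 h).

Local Notation φ x y := (phi (x ⊗ y)).
Local Notation ψ x y := (psi (x ⊗ y)).

Section MatchedPairIdentities.
Hypothesis assoc_right : forall (c h : H1) (x : H2),
  (iota2 x ∙ iota1 c) ∙ iota1 h = iota2 x ∙ iota1 (c ∙ h).
Hypothesis assoc_left : forall (x y : H2) (c : H1),
  iota2 x ∙ (iota2 y ∙ iota1 c) = iota2 (x ∙ y) ∙ iota1 c.

(** This and [psi_mulr] are the [p1]- and [p2]-components of [assoc_right]; [phi_mull] and
    [psi_mull] are those of [assoc_left]. *)
Lemma phi_mulr x c h : φ x (c ∙ h) =
  \sw_(x1, x2 <- x) \sw_(c1, c2 <- c) (φ x1 c1 ∙ φ (ψ x2 c2) h).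
Proof.
rewrite phiE -assoc_right p1_prod_iota1 (sw2_prod21 fact); last by lin.
by apply: eq_sw2 => x1 x2; apply: eq_sw2 => c1 c2; rewrite !phiE psiE.
Qed.

Lemma psi_mulr x c h : ψ x (c ∙ h) = ψ (ψ x c) h.
Proof. by rewrite !psiE -assoc_right p2_prod_iota1. Qed.

Lemma phi_mull x y h : φ (x ∙ y) h = φ x (φ y h).
Proof. by rewrite !phiE -assoc_left p1_iota2_prod. Qed.

Lemma psi_mull x y h : ψ (x ∙ y) h =
  \sw_(y1, y2 <- y) \sw_(h1, h2 <- h) (ψ x (φ y1 h1) ∙ ψ y2 h2).
Proof.
rewrite psiE -assoc_left p2_iota2_prod (sw2_prod21 fact); last by lin.
by apply: eq_sw2 => y1 y2; apply: eq_sw2 => h1 h2; rewrite !psiE phiE.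
Qed.

Lemma phi_onel h : φ (hone H2) h = h.
Proof. by rewrite phiE (iota2_one fact) (uG _).1 (p1_iota1 fact). Qed.

Lemma phi_oner x : φ x (hone H1) = ε x *: hone H1.
Proof. by rewrite phiE (iota1_one fact) (uG _).2 (p1_iota2 fact). Qed.

Lemma psi_onel h : ψ (hone H2) h = ε h *: hone H2.
Proof. by rewrite psiE (iota2_one fact) (uG _).1 (p2_iota1 fact). Qed.

Lemma psi_oner x : ψ x (hone H1) = x.
Proof. by rewrite psiE (iota1_one fact) (uG _).2 (p2_iota2 fact). Qed.

Lemma phi_sw2l (K : hqStruct k) (F : K -> K -> H2) u h :
  \sw_(a, b <- u) φ (F a b) h = φ (sw2 F u) h.
Proof. by rewrite tpure_sw2l linear_sw2. Qed.

Lemma phi_sw2r (K : hqStruct k) (F : K -> K -> H1) u x :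
  \sw_(a, b <- u) φ x (F a b) = φ x (sw2 F u).
Proof. by rewrite tpure_sw2r linear_sw2. Qed.

Lemma psi_sw2l (K : hqStruct k) (F : K -> K -> H2) u h :
  \sw_(a, b <- u) ψ (F a b) h = ψ (sw2 F u) h.
Proof. by rewrite tpure_sw2l linear_sw2. Qed.

Lemma psi_sw2r (K : hqStruct k) (F : K -> K -> H1) u x :
  \sw_(a, b <- u) ψ x (F a b) = ψ x (sw2 F u).
Proof. by rewrite tpure_sw2r linear_sw2. Qed.

(** Expand $\phi(x, T(h_{(2)}g)\, S T(h_{(1)}))$ by [phi_mulr]. The two shapes differ because [T]
    reverses the coproduct of $h_{(2)}g$ exactly when it is odd. *)
Lemma phi_ip_expansion b (T : {linear H1 -> H1}) h g x : twist b T ->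
  ε h *: φ x (T g) = if b then
    \sw_(x1, x2 <- x) \sw_(h1, h2, h3 <- h) \sw_(g1, g2 <- g)
      (φ x1 (T (h3 ∙ g2)) ∙ φ (ψ x2 (T (h2 ∙ g1))) (𝕊 (T h1)))
  else
    \sw_(x1, x2 <- x) \sw_(h1, h2, h3 <- h) \sw_(g1, g2 <- g)
      (φ x1 (T (h2 ∙ g1)) ∙ φ (ψ x2 (T (h3 ∙ g2))) (𝕊 (T h1))).
Proof.
move=> tw; rewrite -(linearZ_LR phi) -tpureZr -(tw_ip tw) -phi_sw2r.
case: b tw => -[_ cT _ _]; rewrite [RHS]sw2_exchange; apply: eq_sw2 => h1 h';
  rewrite phi_mulr; apply: eq_sw2 => x1 x2.
- rewrite (sw2_antimap _ _ cT); last by lin.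
  by rewrite (sw2_hmul muH1) //; lin.
- rewrite (sw2_map _ _ cT); last by lin.
  by rewrite (sw2_hmul muH1) //; lin.
Qed.

(** The inverse and antipode axioms evaluate an action at a product which the antipode or the
    inverse property collapses; the multiplication rules above expand that action. *)
Lemma matched_pair_of_factorization m (T : {linear H1 -> H1})
    (S1_antipode : antipode_identity (hq_antipode H1))
    (S2_antipode : antipode_identity (hq_antipode H2)) :
  Spow m = T :> (H1 -> H1) -> Spow (m + 1) = (fun h => 𝕊 (T h)) :> (H1 -> H1) ->
  twist (odd `|m|%N) T -> matched_pair m phi psi.
Proof.
move=> eT eST tw; split.
- by move=> h x; split; [exact: phi_onel|exact: phi_oner|exact: psi_onel|exact: psi_oner].
- move=> h x; split.
    under eq_sw2 => a b do rewrite -phi_mull.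
    by rewrite phi_sw2l (S2_antipode x).2 tpureZl linearZ_LR phi_onel.
  under eq_sw2 => a b do rewrite -phi_mull.
  by rewrite phi_sw2l (S2_antipode x).1 tpureZl linearZ_LR phi_onel.
- move=> h g x; rewrite eT eST.
  under eq_sw2 => a b do rewrite -psi_mulr.
  by rewrite psi_sw2r (tw_ip tw) tpureZr linearZ_LR.
- move=> h x; split.
    under eq_sw2 => a b do rewrite -psi_mulr.
    by rewrite psi_sw2r (S1_antipode h).2 tpureZr linearZ_LR psi_oner.
  under eq_sw2 => a b do rewrite -psi_mulr.
  by rewrite psi_sw2r (S1_antipode h).1 tpureZr linearZ_LR psi_oner.
- move=> h x; rewrite phiE (p1_coalgebra_map fact).1 (p1_coalgebra_map fact).2.
  rewrite (eps_prod21 fact) (sw2_prod21 fact); last by lin.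
  by split=> //; apply: eq_sw2 => ? ?; apply: eq_sw2 => ? ?; rewrite !phiE.
- move=> h x; rewrite psiE (p2_coalgebra_map fact).1 (p2_coalgebra_map fact).2.
  rewrite (eps_prod21 fact) (sw2_prod21 fact); last by lin.
  by split=> //; apply: eq_sw2 => ? ?; apply: eq_sw2 => ? ?; rewrite !psiE.
- by move=> h g x; rewrite eT eST (phi_ip_expansion h g x tw).
- move=> h x; split.
    (* S reverses the coproduct of $h_{(1)}$, whence the crossed indices 2, 1, 3 in this axiom. *)
    have -> : (ε h * ε x) *: hone H1 = φ x (\sw_(a, b <- h) (𝕊 a ∙ b)).
      by rewrite (S1_antipode h).2 tpureZr linearZ_LR phi_oner scalerA.
    rewrite -phi_sw2r; under [RHS]eq_sw2 => a b do rewrite phi_mulr.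
    rewrite [RHS]sw2_exchange; apply: eq_sw2 => x1 x2.
    rewrite /sw3 -(sw2_coassoc coH1
      (F := fun h1 h2 h3 => φ x1 (𝕊 h2) ∙ φ (ψ x2 (𝕊 h1)) h3)); last by lin.
    by apply: eq_sw2 => a b; rewrite (sw2_antimap _ _ aS1) //; lin.
  have -> : (ε h * ε x) *: hone H1 = φ x (\sw_(a, b <- h) (a ∙ 𝕊 b)).
    by rewrite (S1_antipode h).1 tpureZr linearZ_LR phi_oner scalerA.
  rewrite -phi_sw2r; under [RHS]eq_sw2 => a b do rewrite phi_mulr.
  rewrite [RHS]sw2_exchange; apply: eq_sw2 => x1 x2.
  by rewrite /sw3 -(sw2_coassoc coH1
    (F := fun h1 h2 h3 => φ x1 h1 ∙ φ (ψ x2 h2) (𝕊 h3))); last by lin.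
- move=> h x; split.
    have -> : (ε h * ε x) *: hone H2 = ψ (\sw_(a, b <- x) (𝕊 a ∙ b)) h.
      by rewrite (S2_antipode x).2 tpureZl linearZ_LR psi_onel scalerA mulrC.
    by rewrite -psi_sw2l; apply: eq_sw2 => a b; rewrite psi_mull.
  have -> : (ε h * ε x) *: hone H2 = ψ (\sw_(a, b <- x) (a ∙ 𝕊 b)) h.
    by rewrite (S2_antipode x).1 tpureZl linearZ_LR psi_onel scalerA mulrC.
  rewrite -psi_sw2l; apply: eq_sw2 => a b.
  by rewrite psi_mull (sw2_antimap _ _ aS2) //; lin.
- move=> h x.
  transitivity (\sw_(a, b <- iota2 x ∙ iota1 h) (p2 a ⊗ p1 b)).
    rewrite (sw2_prod21 fact); last by lin.
    by apply: eq_sw2 => a b; apply: eq_sw2 => c d; rewrite phiE psiE.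
  rewrite -(p_swap_bilin fact (F := fun c d => d ⊗ c)); last by lin.
  rewrite (sw2_prod21 fact); last by lin.
  by apply: eq_sw2 => a b; apply: eq_sw2 => c d; rewrite phiE psiE.
Qed.

End MatchedPairIdentities.

(** The operations of the bicrossed product are those of G read through Theta: wherever a factor of
    H2 stands before one of H1, [p_split] reorders them by the two actions. *)
Lemma bowtie_morphism (f : {linear bowtie phi psi -> G})
    (fE : forall (h : H1) (x : H2), f (h ⊗ x) = iota1 h ∙ iota2 x) :
  HQ_morphism f.
Proof.
have bt_ind (W : lmodType k) (u v : bowtie phi psi -> W) : linear u -> linear v ->
    (forall (h : H1) (x : H2), u (h ⊗ x) = v (h ⊗ x)) -> u =1 v by exact: pure_ind.
split.
- move=> s t; apply: (bt_ind _ (fun s => f (s ∙ t)) (fun s => f s ∙ f t)) s => [||h x];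
    [by lin..|].
  apply: (bt_ind _ (fun t => f ((h ⊗ x : bowtie phi psi) ∙ t))
    (fun t => f (h ⊗ x) ∙ f t)) t => [||g y]; [by lin..|].
  (* The product is $h((xg)y)$, and only the middle factor $xg$ has to be split. *)
  rewrite bowtie_mulE !fE assoc_l assoc_r -(p_split fact (iota2 x ∙ iota1 g)).
  rewrite (sw2_prod21 fact); last by lin.
  rewrite linear_sw2 sw2_hmull sw2_hmulr; apply: eq_sw2 => a b.
  rewrite linear_sw2 sw2_hmull sw2_hmulr; apply: eq_sw2 => c d.
  by rewrite fE phiE psiE assoc_l -(morph_mul mor2) assoc_r -(morph_mul mor1).
- move=> c.
  have -> : hq_unit (bowtie phi psi) c = c *: (hone H1 ⊗ hone H2 : bowtie phi psi) by [].
  rewrite linearZ_LR fE (iota1_one fact) (iota2_one fact) (uG _).1 -linearZ_LR.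
  by rewrite [c *: _]mulr1.
- have lf2 : linear (tmap f f) by apply: tlift_linear; lin.
  move=> t; apply: (bt_ind _ (fun t => linear_pack lf2 (Δ t)) (fun t => Δ (f t))) t
    => [||h x]; [by lin..|].
  rewrite bowtie_comulE fE -comul_sw2 (sw2_prod12 fact); last by lin.
  rewrite linear_sw2; apply: eq_sw2 => a b; rewrite linear_sw2; apply: eq_sw2 => c d.
  by rewrite /= /tmap tlift_pure ?fE //; lin.
- move=> t; apply: (bt_ind k^o (fun t => ε (f t)) (fun t => ε t)) t => [||h x];
    [by rewrite /heps; lin..|].
  by rewrite fE (eps_prod12 fact) /heps bowtie_counitE.
- move=> t; apply: (bt_ind _ (fun t => f (𝕊 t)) (fun t => 𝕊 (f t))) t => [||h x]; [by lin..|].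
  (* Here $S(x)S(h)$ is split; both antipodes reverse coproducts, which explains the order of
     indices in [bowtie_antipode]. *)
  rewrite bowtie_antipodeE fE (fa_S12 fact) -[RHS](p_split fact) (sw2_prod21 fact); last by lin.
  rewrite (sw2_antimap _ _ aS2); last by lin.
  rewrite sw2_exchange linear_sw2; apply: eq_sw2 => a b.
  rewrite (sw2_antimap _ _ aS1); last by lin.
  rewrite linear_sw2; apply: eq_sw2 => c d.
  by rewrite fE phiE psiE.
Qed.

End MatchedPairOfFactorization.

(** Theta maps into G, while the isomorphism is required to start from G. *)
Lemma HQ_isomorphic_inverse (k : fieldType) (H K : hqStruct k)
    (f : {linear K -> H}) :
  bijective f -> HQ_morphism f -> HQ_isomorphic H K.
Proof.
case=> g fK gK mf; pose g' := linear_pack (linear_inverse fK gK).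
exists g'; split; first by exists f.
split=> [h h'|c|h|h|h] /=.
- by apply: (can_inj fK); rewrite (morph_mul mf) !gK.
- by apply: (can_inj fK); rewrite (morph_unit mf) gK.
(* With $h = f(g(h))$ the coproduct of [h] is the image under $f \otimes f$ of that of $g(h)$, and
   $g \otimes g$ undoes $f \otimes f$. *)
- rewrite -[in LHS](gK h) -(morph_comul mf).
  have lf2 : linear (tmap f f) by apply: tlift_linear; lin.
  have lg2 : linear (tmap g' g') by apply: tlift_linear; lin.
  apply: (pure_ind (f := fun t => linear_pack lg2 (linear_pack lf2 t)) (g := id)) => [||u v];
    [by lin|by []|].
  rewrite /= /tmap tlift_pure; last by lin.
  have bg : bilin (fun a b => g' a ⊗ g' b) by lin.
  by apply: etrans (tlift_pure bg _ _) _; rewrite /= !fK.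
- by rewrite -[in RHS](gK h) (morph_counit mf).
- by apply: (can_inj fK); rewrite (morph_antipode mf) !gK.
Qed.

(** * The factorization obtained from Theta, and powers of S on mixed products *)

Section ThetaFactorization.
Context (k : fieldType) (H1 H2 G : hqStruct k).
Context (iota1 : {linear H1 -> G}) (iota2 : {linear H2 -> G}).

Lemma Theta_bilin : bilin (fun (h : H1) (x : H2) => iota1 h ∙ iota2 x).
Proof. by lin. Qed.

Hypothesis ab1 : antipodal_bialgebra H1.
Hypothesis ab2 : antipodal_bialgebra H2.
Hypothesis abG : antipodal_bialgebra G.
Hypothesis mor1 : HQ_morphism iota1.
Hypothesis mor2 : HQ_morphism iota2.
Hypothesis S12 : forall (h : H1) (x : H2),
  𝕊 (iota1 h ∙ iota2 x) = iota2 (𝕊 x) ∙ iota1 (𝕊 h).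

Lemma Theta_factorization :
  bijective (tlift (fun (h : H1) (x : H2) => iota1 h ∙ iota2 x)) ->
  (forall (h : H1) (x : H2) (g : G),
    (iota1 h ∙ iota2 x) ∙ g = iota1 h ∙ (iota2 x ∙ g)) ->
  (forall (h : H1) (x : H2) (g : G),
    g ∙ (iota1 h ∙ iota2 x) = (g ∙ iota1 h) ∙ iota2 x) ->
  exists p1 p2, factorization iota1 iota2 p1 p2.
Proof.
case=> Theta' K K' assoc_l assoc_r.
pose Theta := linear_pack (tlift_linear Theta_bilin).
have lT' : linear Theta' := linear_inverse (f := Theta) K K'.
have KE h x : Theta' (iota1 h ∙ iota2 x) = h ⊗ x.
  by rewrite -[RHS]K tlift_pure //; exact: Theta_bilin.
have b1 : bilin (fun (h : H1) (x : H2) => ε x *: h) by lin.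
have b2 : bilin (fun (h : H1) (x : H2) => ε h *: x) by lin.
exists (linear_pack (comp_linear (linear_pack (tlift_linear b1)) lT')).
exists (linear_pack (comp_linear (linear_pack (tlift_linear b2)) lT')).
split=> // [h x|h x|W f g lf lg e u] /=; [by rewrite KE tlift_pure..|].
rewrite -(K' u) -/(Theta _).
apply: (pure_ind (f := fun t => f (Theta t)) (g := fun t => g (Theta t))) => [||h x].
- exact: (comp_linear (linear_pack lf) (linearP Theta)).
- exact: (comp_linear (linear_pack lg) (linearP Theta)).
- by rewrite /Theta /= tlift_pure ?e //; exact: Theta_bilin.
Qed.

Hypothesis S21 : forall (h : H1) (x : H2),
  𝕊 (iota2 x ∙ iota1 h) = iota1 (𝕊 h) ∙ iota2 (𝕊 x).

(** Stated for general maps so as to cover both the antipode and its inverse. *)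
Lemma iter_mixed (f1 : H1 -> H1) (f2 : H2 -> H2) (f : G -> G) n :
  (forall h, iota1 (f1 h) = f (iota1 h)) -> (forall x, iota2 (f2 x) = f (iota2 x)) ->
  (forall h x, f (iota1 h ∙ iota2 x) = iota2 (f2 x) ∙ iota1 (f1 h)) ->
  (forall h x, f (iota2 x ∙ iota1 h) = iota1 (f1 h) ∙ iota2 (f2 x)) ->
  [/\ forall h, iota1 (iter n f1 h) = iter n f (iota1 h),
      forall x, iota2 (iter n f2 x) = iter n f (iota2 x),
      forall h x, iter n f (iota1 h ∙ iota2 x) =
        if odd n then iota2 (iter n f2 x) ∙ iota1 (iter n f1 h)
        else iota1 (iter n f1 h) ∙ iota2 (iter n f2 x)
    & forall h x, iter n f (iota2 x ∙ iota1 h) =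
        if odd n then iota1 (iter n f1 h) ∙ iota2 (iter n f2 x)
        else iota2 (iter n f2 x) ∙ iota1 (iter n f1 h)].
Proof.
move=> e1 e2 e12 e21; elim: n => [|n [i1 i2 i12 i21]]; first by split.
split=> [h|x|h x|h x]; rewrite !iterS.
- by rewrite e1 i1.
- by rewrite e2 i2.
- by rewrite i12 oddS; case: (odd n).
- by rewrite i21 oddS; case: (odd n).
Qed.

Lemma Spow_mixed m :
  [/\ forall h, iota1 (Spow m h) = Spow m (iota1 h),
      forall x, iota2 (Spow m x) = Spow m (iota2 x),
      forall h x, Spow m (iota1 h ∙ iota2 x) =
        if odd `|m|%N then iota2 (Spow m x) ∙ iota1 (Spow m h)
        else iota1 (Spow m h) ∙ iota2 (Spow m x)
    & forall h x, Spow m (iota2 x ∙ iota1 h) =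
        if odd `|m|%N then iota1 (Spow m h) ∙ iota2 (Spow m x)
        else iota2 (Spow m x) ∙ iota1 (Spow m h)].
Proof.
have injS : injective (hq_antipode G) := bij_inj (ab_bij abG).
case: m => n.
  exact: (iter_mixed n (morph_antipode mor1) (morph_antipode mor2) S12 S21).
(* The inverse antipode obeys the same rules, as is seen by applying the injective S of G; this
   exchanges the roles of [S12] and [S21]. *)
apply: (iter_mixed (f1 := @Sinv k H1) (f2 := @Sinv k H2) (f := @Sinv k G) n.+1)
  => [h|x|h x|h x]; apply: injS; rewrite ?(SinvK (ab_bij abG)).
- by rewrite -(morph_antipode mor1) (SinvK (ab_bij ab1)).
- by rewrite -(morph_antipode mor2) (SinvK (ab_bij ab2)).
- by rewrite S21 (SinvK (ab_bij ab1)) (SinvK (ab_bij ab2)).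
- by rewrite S12 (SinvK (ab_bij ab1)) (SinvK (ab_bij ab2)).
Qed.

End ThetaFactorization.

Unset Implicit Arguments.

Theorem proposition3p9 (k : fieldType) (H1 H2 G : hqStruct k)
  (m1 m2 h1 h2 m : int)
  (H1_ip : inverse_property_HQ m1 H1)
  (S1_one : 𝕊 (hone H1) = hone H1)
  (S1_aut : Spow_aut h1 H1)
  (H2_ip : inverse_property_HQ m2 H2)
  (S2_one : 𝕊 (hone H2) = hone H2)
  (S2_aut : Spow_aut h2 H2)
  (m_m1 : (m = m1 %[mod h1])%Z)
  (m_m2 : (m = m2 %[mod h2])%Z)
  (G_ip : inverse_property_HQ m G)
  (iota1 : {linear H1 -> G}) (iota2 : {linear H2 -> G})
  (H1_sub : quasi_subgroup m iota1)
  (H2_sub : quasi_subgroup m iota2)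
  (Theta_bij : bijective (tlift (fun (h : H1) (h' : H2) => iota1 h ∙ iota2 h')))
  (assoc_l : forall (h : H1) (h' : H2) (g : G),
    (iota1 h ∙ iota2 h') ∙ g = iota1 h ∙ (iota2 h' ∙ g))
  (assoc_r : forall (h : H1) (h' : H2) (g : G),
    g ∙ (iota1 h ∙ iota2 h') = (g ∙ iota1 h) ∙ iota2 h')
  (S_l : forall (h : H1) (h' : H2),
    𝕊 (iota1 h ∙ iota2 h') = iota2 (𝕊 h') ∙ iota1 (𝕊 h))
  (S_r : forall (h : H1) (h' : H2),
    𝕊 (iota2 h' ∙ iota1 h) = iota1 (𝕊 h) ∙ iota2 (𝕊 h')) :
  exists (phi : {linear (H2 ⊗ H1)%type -> H1}) (psi : {linear (H2 ⊗ H1)%type -> H2}),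
    matched_pair m phi psi /\ HQ_isomorphic G (bowtie phi psi).
Proof.
case: H1_sub => _ mor1 ip1; case: H2_sub => _ mor2 ip2.
have ab1 := inverse_property_antipodal ip1.
have ab2 := inverse_property_antipodal ip2.
have abG := inverse_property_antipodal G_ip.
have [p1 [p2 fact]] :=
  Theta_factorization ab1 ab2 abG mor1 mor2 S_l Theta_bij assoc_l assoc_r.
have [T1 [e1 tw1]] := Spow_twist ip1.
have [T2 [e2 tw2]] := Spow_twist ip2.
have [T [e tw]] := Spow_twist G_ip.
have tf : twisted_factorization iota1 iota2 (odd `|m|%N) T1 T2 T.
  have := Spow_mixed ab1 ab2 abG mor1 mor2 S_l S_r m.
  by rewrite e1 e2 e => -[? ? ? ?]; split.
have b21 : bilin (fun (x : H2) (h : H1) => iota2 x ∙ iota1 h) by lin.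
(* [M] multiplies in the order opposite to Theta; the actions are its two components. *)
pose M := linear_pack (tlift_linear b21).
have ME x h : M (x ⊗ h) = iota2 x ∙ iota1 h by exact: tlift_pure.
pose phi := linear_pack (comp_linear p1 (linearP M)).
pose psi := linear_pack (comp_linear p2 (linearP M)).
have phiE x h : phi (x ⊗ h) = p1 (iota2 x ∙ iota1 h) by rewrite -ME.
have psiE x h : psi (x ⊗ h) = p2 (iota2 x ∙ iota1 h) by rewrite -ME.
exists phi, psi; split.
  apply: (matched_pair_of_factorization fact phiE psiE _ _ (ip_antipode ip1)
    (ip_antipode ip2) e1 _ tw1) => [c h x|x y c|].
  - exact: (mixed_assoc_right fact c h x tf).
  - exact: (mixed_assoc_left fact x y c tf).
  - by apply: funext => h; rewrite (SpowS (ab_bij ab1)) e1.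
have lTheta := tlift_linear (@Theta_bilin k H1 H2 G iota1 iota2).
(* The carrier of [bowtie phi psi] is $H_1 \otimes H_2$, so Theta itself is the required map. *)
pose Theta : {linear bowtie phi psi -> G} := linear_pack (U := bowtie phi psi) lTheta.
apply: (@HQ_isomorphic_inverse k G (bowtie phi psi) Theta Theta_bij).
apply: (bowtie_morphism fact phiE psiE) => h x.
by apply: tlift_pure; exact: Theta_bilin.
Qed.
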